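(* Let $P,Q\in\mathbb{C}[X]$ be polynomials of the same degree $n=m\ge 2$, written as $$P(X)=a_0+a_1X+\dots+a_{n_0}X^{n_0}+a_nX^n,\qquad Q(X)=b_0+b_1X+\dots+b_{m_0}X^{m_0}+b_mX^m,$$ with $a_n,a_{n_0},b_m,b_{m_0}$ all nonzero and $n_0<n$, $m_0<m$ (so $n_0=\deg(P-a_nX^n)$ and $m_0=\deg(Q-b_mX^m)$). Suppose $n\ge \max\{n_0,m_0\}+4$ and that $P(x)-Q(y)$ has no factor of degree one in $\mathbb{C}[x,y]$. Then the projective plane curve $P(x)=Q(y)$ has no irreducible component of (geometric) genus $0$ or $1$.
   Context: The curve $P(x)=Q(y)$ means the projective closure in $\mathbb{P}^2(\mathbb{C})$ of the affine curve $\{P(x)-Q(y)=0\}$, i.e. the zero set of $F(z_0,z_1,z_2)=z_2^{n}\big(P(z_0/z_2)-Q(z_1/z_2)\big)$. The genus of an irreducible component is its geometric genus. *)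

(* Defs.v *)
From HB Require Import structures.
From mathcomp Require Import all_boot all_order all_algebra.
From mathcomp Require Import complex.
From mathcomp Require Import Rstruct.
From Stdlib Require Import Reals.
Set Implicit Arguments. Unset Strict Implicit. Unset Printing Implicit Defensive.
Import Order.TTheory GRing.Theory Num.Theory.
Local Open Scope ring_scope.

Notation CC := (complex Rdefinitions.R).

(** Bivariate polynomials C[x,y]:  in {poly {poly CC}} the inner variable is
    x and the outer variable is y. *)
Notation bipoly := {poly {poly CC}}.
Definition varx : bipoly := ('X : {poly CC})%:P.
Definition vary : bipoly := 'X.
Definition cst (c : CC) : bipoly := c%:P%:P.

Definition PxQy (P Q : {poly CC}) : bipoly := P%:P - map_poly polyC Q.

Definition bdvd (f g : bipoly) : Prop := exists h : bipoly, g = f * h.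
Definition birreducible (f : bipoly) : Prop :=
  f != 0 /\ f \isn't a GRing.unit /\
  forall g h : bipoly, f = g * h -> g \is a GRing.unit \/ h \is a GRing.unit.

Definition deg_one (f : bipoly) : Prop :=
  exists a b c : CC, (b != 0 \/ c != 0) /\ f = cst a + cst b * varx + cst c * vary.

(** ---------------------------------------------------------------------
    Function fields and their genus (following Stichtenoth, "Algebraic
    Function Fields and Codes", Def. 1.4.15:  g = max_A (deg A - l(A) + 1)).
    --------------------------------------------------------------------- *)

(** [K] (with the constant embedding [iota] and [phi]) is the function field
    Frac(C[x,y]/(f)) of the irreducible plane curve f = 0:  phi : C[x,y] -> K
    is a ring morphism, constant on constants, with kernel exactly (f), and
    every element of K is a quotient of two elements of the image. *)
Definition is_function_field_of (f : bipoly) (K : fieldType)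
    (iota : {rmorphism CC -> K}) (phi : {rmorphism bipoly -> K}) : Prop :=
  (forall c : CC, phi (cst c) = iota c) /\
  (forall g : bipoly, phi g = 0 <-> bdvd f g) /\
  (forall a : K, exists g h : bipoly, phi h != 0 /\ a = phi g / phi h).

Section FunctionField.
Variables (K : fieldType) (iota : {rmorphism CC -> K}).

(** a place of K/C, given by its valuation ring O  (C <= O <> K) *)
Definition is_place (O : K -> Prop) : Prop :=
  [/\ O 0 /\ O 1, (forall a b, O a -> O b -> O (a - b)),
      (forall a b, O a -> O b -> O (a * b)),
      (forall c : CC, O (iota c)) &
      (forall a : K, a != 0 -> O a \/ O a^-1) /\ (exists a : K, ~ O a)].

Definition uniformizer (O : K -> Prop) (t : K) : Prop :=
  [/\ O t, t != 0, ~ O t^-1 &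
      forall b : K, O b -> ~ O b^-1 -> O (b / t)].

Definition val_ge (O : K -> Prop) (a : K) (m : int) : Prop :=
  exists t : K, uniformizer O t /\ O (a / t ^ m).

Definition same_place (O1 O2 : K -> Prop) : Prop := forall a, O1 a <-> O2 a.

Definition is_divisor (D : seq ((K -> Prop) * int)) : Prop :=
  (forall e, List.In e D -> is_place e.1) /\
  (forall i j : nat, leq i.+1 j -> leq j.+1 (size D) ->
     ~ same_place (nth (fun _ => False, 0) D i).1 (nth (fun _ => False, 0) D j).1).

Definition deg_div (D : seq ((K -> Prop) * int)) : int := \sum_(e <- D) e.2.

Definition in_LD (D : seq ((K -> Prop) * int)) (a : K) : Prop :=
  a = 0 \/
  ((forall e, List.In e D -> val_ge e.1 a (- e.2)) /\
   (forall O, is_place O -> (forall e, List.In e D -> ~ same_place O e.1) ->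
      val_ge O a 0)).

Definition indep_in_LD (D : seq ((K -> Prop) * int)) (k : nat) : Prop :=
  exists s : 'I_k -> K, (forall i, in_LD D (s i)) /\
    forall c : 'I_k -> CC, \sum_(i < k) iota (c i) * s i = 0 -> forall i, c i = 0.

Definition ell (D : seq ((K -> Prop) * int)) (k : nat) : Prop :=
  indep_in_LD D k /\ ~ indep_in_LD D k.+1.

Definition has_genus (g : nat) : Prop :=
  (forall D k, is_divisor D -> ell D k -> deg_div D - k%:Z + 1 <= g%:Z) /\
  (exists D k, is_divisor D /\ ell D k /\ deg_div D - k%:Z + 1 = g%:Z).

End FunctionField.

Definition curve_has_genus (f : bipoly) (g : nat) : Prop :=
  forall (K : fieldType) (iota : {rmorphism CC -> K}) (phi : {rmorphism bipoly -> K}),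
    is_function_field_of f iota phi -> has_genus iota g.

(* Main.v *)
(** The proof exhibits holomorphic differentials. Put [eta = x dy - y dx] on an
    irreducible component [f]. It has no poles at finite places. The curve meets the
    line at infinity in points where [x = c y + eps] with distinct values of [c], and
    the gap in the degrees of [P] and [Q] gives [eps = O(y^-3)], so that
    [eta = eps dy - y d(eps)] and even [y eta] are holomorphic at infinity. As [f] is
    not a line, [eps] has a finite order [m >= 3] at a chosen place [p] at infinity,
    and by the residue theorem for [h eta] and [h y eta] a function [h] with no pole
    outside [p] cannot have a pole of order [m - 1] or [m - 2] at [p]. Hence
    [l((m - 1) p) <= m - 2], which the definition of the genus turns into
    [g >= 2].

    No theory of differentials is needed for the residue theorem. The residue of
    [h eta] is the residue of [(h x) dy] minus that of [(h y) dx]; if [h] is integral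
    over [C[x]] and [C[y]], the trace of [h x] to [C(y)] and the trace of [h y] to
    [C(x)] are polynomials, and these have no residue at infinity. The traces are
    computed as sums over the embeddings of the function field into the field of
    Laurent series in [s = 1 / y] (respectively [s = 1 / x]) given by the places at
    infinity, which come from Hensel's lemma. *)
Require Import Defs.
From HB Require Import structures.
From mathcomp Require Import all_boot all_order all_algebra.
From mathcomp Require Import complex Rstruct.
From mathcomp Require Import boolp classical_sets.
From mathcomp Require Import separable.
From mathcomp Require Import zify ring.
Set Implicit Arguments. Unset Strict Implicit. Unset Printing Implicit Defensive.
Import Order.TTheory GRing.Theory Num.Theory.
Local Open Scope ring_scope.

(** * Power series *)

Record fps (k : fieldType) := Fps { fcoef :> nat -> k }.

HB.instance Definition _ (k : fieldType) := gen_eqMixin (fps k).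
HB.instance Definition _ (k : fieldType) := gen_choiceMixin (fps k).

Section PowerSeries.
Variable k : fieldType.
Implicit Types a b c : fps k.

Lemma fpsP a b : (forall n, a n = b n) -> a = b.
Proof. by case: a b => [f] [g] /= fg; congr Fps; apply: funext. Qed.

Definition fps_add a b := Fps (fun n => a n + b n).
Definition fps_opp a := Fps (fun n => - a n).
Definition fps_const (x : k) := Fps (fun n => if n is 0%N then x else 0).
Definition fps_mul a b := Fps (fun n => \sum_(i < n.+1) a i * b (n - i)%N).

Lemma fps_addA : associative fps_add.
Proof. by move=> a b c; apply: fpsP => n /=; rewrite addrA. Qed.
Lemma fps_addC : commutative fps_add.
Proof. by move=> a b; apply: fpsP => n /=; rewrite addrC. Qed.
Lemma fps_add0 : left_id (fps_const 0) fps_add.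
Proof. by move=> a; apply: fpsP => -[|n] /=; rewrite add0r. Qed.
Lemma fps_addN : left_inverse (fps_const 0) fps_opp fps_add.
Proof. by move=> a; apply: fpsP => -[|n] /=; rewrite addNr. Qed.

HB.instance Definition _ :=
  GRing.isZmodule.Build (fps k) fps_addA fps_addC fps_add0 fps_addN.

Definition fps_trunc n a : {poly k} := \poly_(i < n) a i.

(** The coefficient of index [n] of a product involves only indices up to [n], so associativity and
    commutativity of series are inherited from polynomials through truncation. *)
Lemma coef_fps_mul a b (p q : {poly k}) n :
    (forall i, (i <= n)%N -> p`_i = a i) -> (forall i, (i <= n)%N -> q`_i = b i) ->
  (p * q)`_n = fps_mul a b n.
Proof.
move=> pa qb; rewrite coefM; apply: eq_bigr => i _.
by rewrite pa ?qb ?leq_subr // -ltnS.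
Qed.

Lemma coef_fps_trunc n a i : (i < n)%N -> (fps_trunc n a)`_i = a i.
Proof. by move=> lt_in; rewrite coef_poly lt_in. Qed.

Lemma fps_mulA : associative fps_mul.
Proof.
move=> a b c; apply: fpsP => n.
pose T := fps_trunc n.+1.
have Tmul d e i : (i <= n)%N -> (T d * T e)`_i = fps_mul d e i.
  move=> le_in; apply: coef_fps_mul => j le_ji;
    by rewrite coef_fps_trunc // ltnS (leq_trans le_ji).
rewrite -(@coef_fps_mul _ _ (T a) (T b * T c)) //; last first.
- by move=> i le_in; exact: Tmul.
- by move=> i le_in; rewrite coef_fps_trunc.
rewrite mulrA; apply: coef_fps_mul => i le_in; first exact: Tmul.
by rewrite coef_fps_trunc.
Qed.

Lemma fps_mulC : commutative fps_mul.
Proof.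
move=> a b; apply: fpsP => n.
pose T := fps_trunc n.+1.
rewrite -(@coef_fps_mul a b (T a) (T b)); last 2 first.
- by move=> i le_in; rewrite coef_fps_trunc.
- by move=> i le_in; rewrite coef_fps_trunc.
rewrite mulrC; apply: coef_fps_mul => i le_in; by rewrite coef_fps_trunc.
Qed.

Lemma fps_mul1 : left_id (fps_const 1) fps_mul.
Proof.
move=> a; apply: fpsP => n /=.
rewrite big_ord_recl /= mul1r subn0 big1 ?addr0 // => i _.
by rewrite /bump /= mul0r.
Qed.

Lemma fps_mulDl : left_distributive fps_mul fps_add.
Proof.
move=> a b c; apply: fpsP => n /=; rewrite -big_split /=.
by apply: eq_bigr => i _; rewrite mulrDl.
Qed.

Lemma fps_1neq0 : fps_const 1 != 0.
Proof. by apply/eqP => /(congr1 (fun a : fps k => a 0%N)) /= /eqP; rewrite oner_eq0. Qed.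

HB.instance Definition _ := GRing.Zmodule_isComNzRing.Build (fps k)
  fps_mulA fps_mulC fps_mul1 fps_mulDl fps_1neq0.

Definition fps_cons (x : k) a := Fps (fun n => if n is m.+1 then a m else x).
Definition fps_behead a := Fps (fun n => a n.+1).
Definition fps_X : fps k := fps_cons 0 1.

Lemma fps_addE a b n : (a + b) n = a n + b n. Proof. by []. Qed.
Lemma fps_subE a b n : (a - b) n = a n - b n. Proof. by []. Qed.
Lemma fps_zeroE n : (0 : fps k) n = 0. Proof. by case: n. Qed.
Lemma fps_oneE n : (1 : fps k) n = (n == 0%N)%:R. Proof. by case: n. Qed.
Lemma fps_mulE a b n : (a * b) n = \sum_(i < n.+1) a i * b (n - i)%N.
Proof. by []. Qed.
Lemma fps_mulE0 a b : (a * b) 0%N = a 0%N * b 0%N.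
Proof. by rewrite fps_mulE big_ord_recl big_ord0 addr0. Qed.
Lemma fps_sumE (I : Type) (r : seq I) (P : pred I) (F : I -> fps k) n :
  (\sum_(i <- r | P i) F i) n = \sum_(i <- r | P i) F i n.
Proof.
by elim/big_rec2: _ => [|i x y _ <- //]; rewrite fps_zeroE.
Qed.

Lemma fps_constME x a n : (fps_const x * a) n = x * a n.
Proof.
rewrite fps_mulE big_ord_recl /= subn0 big1 ?addr0 // => i _.
by rewrite mul0r.
Qed.

Lemma fps_XME a n : (fps_X * a) n = if n is m.+1 then a m else 0.
Proof.
case: n => [|n]; first by rewrite fps_mulE0 mul0r.
rewrite fps_mulE big_ord_recl /= mul0r add0r.
rewrite big_ord_recl /= mul1r subn1 big1 ?addr0 // => i _.
by rewrite mul0r.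
Qed.

Lemma fps_XnME m a n : (fps_X ^+ m * a) n = if (n < m)%N then 0 else a (n - m)%N.
Proof.
elim: m n => [|m IHm] n; first by rewrite mul1r subn0.
by rewrite exprS -mulrA fps_XME; case: n => // n; rewrite IHm ltnS subSS.
Qed.

Lemma fps_beheadK a : a 0%N = 0 -> a = fps_X * fps_behead a.
Proof. by move=> a0; apply: fpsP => -[|n]; rewrite fps_XME. Qed.

Lemma fps_dropK m a : (forall i, (i < m)%N -> a i = 0) ->
  a = fps_X ^+ m * Fps (fun n => a (n + m)%N).
Proof.
move=> a0; apply: fpsP => n; rewrite fps_XnME.
by case: ltnP => [/a0 //|le_mn] /=; rewrite subnK.
Qed.

Lemma fps_const_is_zmod_morphism : zmod_morphism fps_const.
Proof. by move=> x y; apply: fpsP => -[|n] //; rewrite fps_subE /= subr0. Qed.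
Lemma fps_const_is_monoid_morphism : monoid_morphism fps_const.
Proof.
split=> // x y; apply: fpsP => n; rewrite fps_constME; case: n => //= n.
by rewrite mulr0.
Qed.
HB.instance Definition _ :=
  GRing.isZmodMorphism.Build k (fps k) fps_const fps_const_is_zmod_morphism.
HB.instance Definition _ :=
  GRing.isMonoidMorphism.Build k (fps k) fps_const fps_const_is_monoid_morphism.

Definition fps_ct a : k := a 0%N.
Lemma fps_ct_is_zmod_morphism : zmod_morphism fps_ct. Proof. by []. Qed.
Lemma fps_ct_is_monoid_morphism : monoid_morphism fps_ct.
Proof. by split=> // a b; exact: fps_mulE0. Qed.
HB.instance Definition _ :=
  GRing.isZmodMorphism.Build (fps k) k fps_ct fps_ct_is_zmod_morphism.
HB.instance Definition _ :=
  GRing.isMonoidMorphism.Build (fps k) k fps_ct fps_ct_is_monoid_morphism.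

Lemma fps_ctM a b : fps_ct (a * b) = fps_ct a * fps_ct b. Proof. exact: rmorphM. Qed.
Lemma fps_ctD a b : fps_ct (a + b) = fps_ct a + fps_ct b. Proof. by []. Qed.
Lemma fps_ctB a b : fps_ct (a - b) = fps_ct a - fps_ct b. Proof. by []. Qed.
Lemma fps_ct_const x : fps_ct (fps_const x) = x. Proof. by []. Qed.
Lemma fps_ctX : fps_ct fps_X = 0. Proof. by []. Qed.

Lemma fps_split a : a = fps_const (fps_ct a) + fps_X * fps_behead a.
Proof.
by apply: fpsP => -[|n]; rewrite fps_addE fps_XME /= ?addr0 ?add0r.
Qed.

Lemma fps_X_neq0 : fps_X != 0.
Proof.
apply/eqP => /(congr1 (fun a : fps k => a 1%N)) /= /eqP.
by rewrite oner_eq0.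
Qed.

Lemma fps_valuation a : a != 0 -> exists m u, a = fps_X ^+ m * u /\ fps_ct u != 0.
Proof.
move=> a_neq0.
have [n an] : exists n, a n != 0.
  apply: contrapT => no; case/eqP: a_neq0; apply: fpsP => n.
  by apply/eqP; rewrite fps_zeroE; apply: contrapT => an; apply: no; exists n; apply/negP.
case: (ex_minnP (ex_intro (fun n => a n != 0) n an)) => m am min_m.
exists m, (Fps (fun n => a (n + m)%N)); split=> //; apply: fps_dropK => i lt_im.
by apply: contraTeq lt_im => /min_m; rewrite -leqNgt.
Qed.

Lemma fps_mulf_eq0 a b : a * b = 0 -> (a == 0) || (b == 0).
Proof.
move=> ab0; apply: contrapT => /negP; rewrite negb_or => /andP[].
move=> /fps_valuation[m [u [Da u0]]] /fps_valuation[n [v [Db v0]]].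
(* The coefficient of index [m + n] of the product is the product of the two lowest nonzero
   coefficients. *)
have /eqP := congr1 (fun c : fps k => c (m + n)%N) ab0.
rewrite Da Db mulrACA -exprD fps_XnME ltnn subnn fps_zeroE.
by rewrite fps_mulE0 mulf_eq0; apply/negP; rewrite negb_or u0.
Qed.

(** The first [n + 1] coefficients of the inverse, kept as a list because each new one depends on
    all the previous ones. *)
Fixpoint fps_invl (a : fps k) n : seq k :=
  if n is m.+1 then
    let s := fps_invl a m in
    rcons s (- (a 0%N)^-1 * \sum_(i < m.+1) a i.+1 * s`_(m - i))
  else [:: (a 0%N)^-1].

Lemma size_fps_invl a n : size (fps_invl a n) = n.+1.
Proof. by elim: n => //= n IHn; rewrite size_rcons IHn. Qed.

Lemma nth_fps_invl a n i : (i <= n)%N -> (fps_invl a n)`_i = (fps_invl a i)`_i.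
Proof.
elim: n => [|n IHn]; first by rewrite leqn0 => /eqP ->.
rewrite leq_eqVlt => /orP[/eqP -> //|lt_in].
by rewrite /= nth_rcons size_fps_invl lt_in IHn.
Qed.

Lemma fps_unit a : fps_ct a != 0 -> exists b, a * b = 1.
Proof.
move=> a0; exists (Fps (fun n => (fps_invl a n)`_n)); apply: fpsP => -[|n].
  by rewrite fps_mulE0 /= divff.
rewrite fps_mulE fps_oneE big_ord_recl /= nth_rcons size_fps_invl ltnn eqxx.
rewrite mulrA mulrN divff // mulN1r; apply/eqP; rewrite addrC subr_eq0; apply/eqP.
by apply: eq_bigr => i _; rewrite /bump /= subSS (@nth_fps_invl _ n) ?leq_subr.
Qed.

Definition fps_is_unit : pred (fps k) := fun a => `[< exists b, b * a = 1 >].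
Definition fps_inv a : fps k :=
  if pselect (exists b, b * a = 1) is left H then projT1 (cid H) else a.

Lemma fps_mulVr : {in fps_is_unit, left_inverse 1 fps_inv *%R}.
Proof.
move=> a /asboolP ua; rewrite /fps_inv; case: pselect => // H.
exact: (projT2 (cid H)).
Qed.
Lemma fps_unitP a b : b * a = 1 -> fps_is_unit a.
Proof. by move=> ba; apply/asboolP; exists b. Qed.
Lemma fps_inv_out : {in [predC fps_is_unit], fps_inv =1 id}.
Proof.
move=> a /negP ua; rewrite /fps_inv; case: pselect => // H.
by case: ua; apply/asboolP.
Qed.

HB.instance Definition _ := GRing.ComNzRing_hasMulInverse.Build (fps k)
  fps_mulVr fps_unitP fps_inv_out.
HB.instance Definition _ := GRing.ComUnitRing_isIntegral.Build (fps k) fps_mulf_eq0.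

End PowerSeries.

Arguments fps_ct {k} a : simpl never.
Arguments fps_const {k} x : simpl never.
Arguments fps_X {k}.

(* The substitution inverse to [s |-> t]: expanding [a] in powers of the
   uniformizer [t] gives the coefficients of its image, so that [t |-> s]. *)
Section ChangeOfUniformizer.
Variables (k : fieldType) (t v : fps k).
Hypotheses (t0 : fps_ct t = 0) (tv : t * v = fps_X).
Implicit Types a b : fps k.

(** As [t * v = fps_X], this is $(a - a(0))/t$, one step of the expansion in powers of [t]. *)
Definition expand_tail a := v * fps_behead a.

Lemma expand_tailE a : a = fps_const (fps_ct a) + t * expand_tail a.
Proof. by rewrite /expand_tail mulrA tv -fps_split. Qed.

Lemma expand_unif_neq0 : t != 0.
Proof. by apply: contra_neq (fps_X_neq0 k) => t_eq0; rewrite -tv t_eq0 mul0r. Qed.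

(** Since [t] is nonzero with zero constant term, the splitting into a constant and a multiple of
    [t] is unique; tails of sums and products are found by exhibiting such a splitting. *)
Lemma expand_tail_uniq a x b : a = fps_const x + t * b -> expand_tail a = b.
Proof.
move=> Da; have Dx : fps_ct a = x.
  by rewrite Da fps_ctD fps_ctM t0 mul0r addr0.
apply: (mulfI expand_unif_neq0); apply: (addrI (fps_const x)).
by rewrite -Da [RHS](expand_tailE a) Dx.
Qed.

Definition expand a : fps k := Fps (fun n => fps_ct (iter n expand_tail a)).

Lemma expand_recE a : expand a = fps_const (fps_ct a) + fps_X * expand (expand_tail a).
Proof.
apply: fpsP => -[|n]; rewrite fps_addE fps_XME /= ?addr0 ?add0r //.
by rewrite -iterSr.
Qed.

Lemma expand_is_zmod_morphism : zmod_morphism expand.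
Proof.
move=> a b; apply: fpsP => n; rewrite fps_subE.
elim: n a b => [//|n IHn] a b; rewrite /= -!iterS !iterSr -/(expand _ n) -IHn.
congr (fps_ct (iter n _ _)); apply: (@expand_tail_uniq _ (fps_ct (a - b))).
rewrite [in LHS](expand_tailE a) [in LHS](expand_tailE b) fps_ctB (rmorphB (@fps_const k)) mulrBr opprD addrACA //.
Qed.

Lemma expand_is_monoid_morphism : monoid_morphism expand.
Proof.
have tail1 : expand_tail 1 = 0.
  by apply: (@expand_tail_uniq _ 1); rewrite mulr0 addr0 rmorph1.
have expand0 : expand 0 = 0.
  by have := expand_is_zmod_morphism 0 0; rewrite !subrr.
split=> [|a b].
  by rewrite expand_recE tail1 expand0 mulr0 addr0 !rmorph1.
apply: fpsP => n; elim: n a b => [|n IHn] a b; first by rewrite fps_mulE0 /= rmorphM.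
(* Product rule for tails, from $ab = a(0)b + ta'b$; keeping [b] whole in the second term matches
   the recursion for products of series. *)
have tailM : expand_tail (a * b) =
    fps_const (fps_ct a) * expand_tail b + expand_tail a * b.
  apply: (@expand_tail_uniq _ (fps_ct (a * b))).
  rewrite {1}(expand_tailE a) mulrDl {1}(expand_tailE b) mulrDr fps_ctM.
  by rewrite (rmorphM (@fps_const k)) mulrDr !mulrA (mulrC t (fps_const _)) addrA.
have expandD c d m : expand (c + d) m = expand c m + expand d m.
  have := expand_is_zmod_morphism c (- d); rewrite opprK => ->.
  rewrite fps_subE -[- d]sub0r expand_is_zmod_morphism expand0 fps_subE.
  by rewrite fps_zeroE sub0r opprK.
have tailC x : expand_tail (fps_const x) = 0.
  by apply: (@expand_tail_uniq _ x); rewrite mulr0 addr0.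
have expandC x : expand (fps_const x) = fps_const x.
  by rewrite expand_recE tailC expand0 mulr0 addr0.
rewrite (expand_recE (a * b)) tailM fps_addE fps_XME [fps_const _ _]/= add0r.
rewrite expandD !IHn expandC [in RHS](expand_recE a) mulrDl fps_addE.
rewrite -mulrA fps_XME !fps_constME; congr (_ * _ + _).
by rewrite [in RHS](expand_recE b) fps_addE fps_XME add0r.
Qed.

HB.instance Definition _ :=
  GRing.isZmodMorphism.Build (fps k) (fps k) expand expand_is_zmod_morphism.
HB.instance Definition _ :=
  GRing.isMonoidMorphism.Build (fps k) (fps k) expand expand_is_monoid_morphism.

Definition expand_rmorphism : {rmorphism fps k -> fps k} := expand.

Lemma expand_unif : expand t = fps_X.
Proof.
have -> : expand t = fps_const (fps_ct t) + fps_X * expand 1.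
  by rewrite expand_recE (@expand_tail_uniq t 0 1) // mulr1 rmorph0 add0r.
by rewrite t0 !rmorph1 mulr1 rmorph0 add0r.
Qed.

Lemma expand_const x : expand (fps_const x) = fps_const x.
Proof.
have tailC : expand_tail (fps_const x) = 0.
  by apply: (@expand_tail_uniq _ x); rewrite mulr0 addr0.
by rewrite expand_recE tailC rmorph0 mulr0 addr0.
Qed.

Lemma fps_ct_expand a : fps_ct (expand a) = fps_ct a. Proof. by []. Qed.

(** A nonzero series is $X^m$ times a unit. The expansion keeps constant terms, so units stay
    nonzero, and $X = tv$ goes to $X$ times such a unit because [v] is one. *)
Lemma expand_inj a : expand a = 0 -> a = 0.
Proof.
have v0 : fps_ct v != 0.
  have tv1 : fps_behead t * v = 1.
    by apply: (mulfI (fps_X_neq0 k)); rewrite mulrA -fps_beheadK // tv mulr1.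
  apply: contra_neq (oner_neq0 k) => v0.
  by have := congr1 fps_ct tv1; rewrite fps_ctM v0 mulr0.
have ct_neq0 c : fps_ct c != 0 -> expand c != 0.
  by apply: contra_neq => c0; rewrite -fps_ct_expand c0.
move=> a0; apply: contrapT => /eqP /fps_valuation[m [u [Da u0]]].
move/eqP: a0; rewrite Da rmorphM rmorphXn -tv rmorphM /= mulf_eq0 => /orP[|].
  by rewrite expf_eq0 => /andP[_]; rewrite expand_unif mulf_eq0 (negPf (fps_X_neq0 _)) (negPf (ct_neq0 _ _)).
by rewrite (negPf (ct_neq0 _ _)).
Qed.

End ChangeOfUniformizer.

(** Each element gets a chosen numerator and denominator; equality of the kernels makes the value
    independent of the choice. *)
Lemma extend_to_fractions (A : nzRingType) (K F : fieldType)
    (phi : {rmorphism A -> K}) (e : {rmorphism A -> F}) :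
    (forall u, exists g h, phi h != 0 /\ u = phi g / phi h) ->
    (forall a, phi a = 0 <-> e a = 0) ->
  exists sigma : {rmorphism K -> F}, forall a, sigma (phi a) = e a.
Proof.
move=> fracK ker.
have /choice[num /choice[den numdenP]] := fracK.
have e_neq0 h : phi h != 0 -> e h != 0.
  by apply: contra_neq => /ker.
have e_eq a b : phi a = phi b -> e a = e b.
  move=> ab; apply/eqP; rewrite -subr_eq0 -rmorphB; apply/eqP/ker.
  by rewrite rmorphB ab subrr.
pose s u := e (num u) / e (den u).
have sE g h : phi h != 0 -> s (phi g / phi h) = e g / e h.
  move=> h0; case: (numdenP (phi g / phi h)) => d0 /eqP.
  rewrite /s; set n := num _; set d := den _ in d0 *.
  rewrite eqr_div // => /eqP Dgh; apply/eqP; rewrite eqr_div ?e_neq0 //.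
  by rewrite -!rmorphM (e_eq (n * h) (g * d)) // !rmorphM Dgh.
have s_zmod : zmod_morphism s.
  move=> u v; have [[du Du] [dv Dv]] := (numdenP u, numdenP v).
  rewrite {1}Du {1}Dv -mulNr addf_div // -rmorphN -!rmorphM -rmorphD sE ?rmorphM ?mulf_neq0 //.
  by rewrite /s -mulNr addf_div ?e_neq0 // rmorphD !rmorphM rmorphN.
have s_monoid : monoid_morphism s.
  split=> [|u v].
    by rewrite -[1](divr1) -(rmorph1 phi) sE ?rmorph1 ?divr1 ?oner_eq0.
  have [[du Du] [dv Dv]] := (numdenP u, numdenP v).
  rewrite {1}Du {1}Dv mulf_div -!rmorphM sE ?rmorphM ?mulf_neq0 //.
  by rewrite /s mulf_div.
pose sA := GRing.isZmodMorphism.Build K F s s_zmod.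
pose sM := GRing.isMonoidMorphism.Build K F s s_monoid.
pose sR : {rmorphism K -> F} := HB.pack s sA sM.
exists sR => a; rewrite -[a in LHS]mulr1 -[phi _]divr1 -(rmorph1 phi) mulr1.
by rewrite [LHS]sE ?rmorph1 ?divr1 ?oner_eq0.
Qed.

(** * Hensel's lemma and Laurent series *)

Section Hensel.
Variable k : fieldType.

Lemma horner_taylor2 (R : comNzRingType) (p : {poly R}) (u h : R) :
  exists q, p.[u + h] = p.[u] + p^`().[u] * h + h ^+ 2 * q.
Proof.
elim/poly_ind: p => [|p c [q Dq]]; first by exists 0; rewrite deriv0 !hornerC; ring.
exists (q * (u + h) + p^`().[u]).
by rewrite derivD derivM derivX derivC !hornerE Dq; ring.
Qed.

(** Newton's iteration [T], with the slope frozen at [l], is a contraction for the $X$-adic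
    topology; its fixed point is the root. *)
Lemma hensel (p : {poly fps k}) (c : k) :
    (map_poly fps_ct p).[c] = 0 -> (map_poly fps_ct p)^`().[c] != 0 ->
  exists w, fps_ct w = c /\ p.[w] = 0.
Proof.
move=> pc0; set l := _.[c] => l0.
pose T u := u - fps_const l^-1 * p.[u].
have ctp u q : fps_ct u = c -> fps_ct q.[u] = (map_poly fps_ct q).[c].
  by move=> <-; rewrite horner_map.
have ctT u : fps_ct u = c -> fps_ct (T u) = c.
  by move=> uc; rewrite fps_ctB fps_ctM (ctp u p) // pc0 mulr0 subr0.
(* Up to a quadratic term the error is multiplied by $1 - p'(u)/l$, whose constant term vanishes:
   one power of the variable is gained. *)
have contr m u h : fps_ct u = c ->
    exists g, T (u + fps_X ^+ m.+1 * h) - T u = fps_X ^+ m.+2 * g.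
  move=> uc; have [q Dq] := horner_taylor2 p u (fps_X ^+ m.+1 * h).
  pose e := 1 - fps_const l^-1 * p^`().[u].
  have De : e = fps_X * fps_behead e.
    apply: fps_beheadK; rewrite -/(fps_ct e) fps_ctB fps_ctM (ctp u _ uc).
    by rewrite -deriv_map fps_ct_const mulVf ?subrr.
  exists (fps_behead e * h - fps_const l^-1 * fps_X ^+ m * h ^+ 2 * q).
  have -> : fps_X ^+ m.+2 * (fps_behead e * h - fps_const l^-1 * fps_X ^+ m * h ^+ 2 * q) =
      (fps_X * fps_behead e) * (fps_X ^+ m.+1 * h) -
      fps_const l^-1 * (fps_X ^+ m.+1 * h) ^+ 2 * q by rewrite !exprS; ring.
  rewrite -De /T Dq /e; move: (fps_const _) (p^`().[u]) p.[u] (_ * h) => L d v H.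
  by ring.
pose w_ n := iter n T (fps_const c).
have ctw n : fps_ct (w_ n) = c by elim: n => //= n IHn; exact: ctT.
have w_S n : exists g, w_ n.+1 = w_ n + fps_X ^+ n.+1 * g.
  elim: n => [|n [g Dg]].
    have d0 : fps_ct (w_ 1%N - w_ 0%N) = 0 by rewrite fps_ctB !ctw subrr.
    by exists (fps_behead (w_ 1%N - w_ 0%N)); rewrite expr1 -(fps_beheadK d0) addrC subrK.
  have [g' Dg'] := contr n (w_ n) g (ctw n).
  by exists g'; rewrite -Dg' -Dg addrC subrK.
have w_le m n i : (m <= n)%N -> (i <= m)%N -> w_ n i = w_ m i.
  move=> le_mn le_im; elim: n le_mn => [|n IHn]; first by rewrite leqn0 => /eqP ->.
  rewrite leq_eqVlt => /orP[/eqP -> //|]; rewrite ltnS => le_mn.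
  have [g ->] := w_S n; rewrite fps_addE fps_XnME ltnS (leq_trans le_im) //.
  by rewrite addr0 IHn.
(* Diagonal limit: the coefficient of index [n] is stationary from the iterate [w_ n] on. *)
pose w := Fps (fun n => w_ n n).
have wE n : exists g, w = w_ n + fps_X ^+ n.+1 * g.
  exists (Fps (fun i => (w - w_ n) (i + n.+1)%N)); rewrite -fps_dropK.
    by rewrite addrC subrK.
  move=> i le_in; rewrite fps_subE /= -(w_le i n i) ?subrr //.
exists w; split; first exact: ctw 0%N.
have : w - T w = 0.
  apply: fpsP => n; rewrite fps_zeroE.
  have [[g Dg] [g' Dg']] := (wE n, wE n.+1).
  have [g2 Dg2] := contr n (w_ n) g (ctw n).
  have -> : w - T w = fps_X ^+ n.+2 * (g' - g2).
    rewrite mulrBr -Dg2 -Dg -[T (w_ n)]/(w_ n.+1) {1}Dg'.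
    by move: (T w) (w_ n.+1) (_ * g') => x y z; rewrite opprB addrA [y + z]addrC.
  by rewrite fps_XnME leqW.
rewrite /T opprB addrC subrK => /eqP; rewrite mulf_eq0 fmorph_eq0.
by rewrite invr_eq0 (negPf l0) => /eqP.
Qed.

End Hensel.

Definition peval (R : nzRingType) (S : comNzRingType) (f : {rmorphism R -> S})
  (u : S) : {rmorphism {poly R} -> S} := horner_morph (fun a => mulrC u (f a)).

Lemma pevalE (R : nzRingType) (S : comNzRingType) (f : {rmorphism R -> S}) u p :
  peval f u p = (map_poly f p).[u].
Proof. by []. Qed.

Lemma pevalC (R : nzRingType) (S : comNzRingType) (f : {rmorphism R -> S}) u c :
  peval f u c%:P = f c.
Proof. exact: horner_morphC. Qed.

Lemma pevalX (R : nzRingType) (S : comNzRingType) (f : {rmorphism R -> S}) u :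
  peval f u 'X = u.
Proof. exact: horner_morphX. Qed.

Notation laurent k := {fraction (fps k)}.

Section Laurent.
Variable k : fieldType.
Implicit Types (u v : laurent k) (a b : fps k).

Definition lser : {rmorphism fps k -> laurent k} := @FracField.tofrac (fps k).
Definition lconst : {rmorphism k -> laurent k} := lser \o @fps_const k.
Definition lvar : laurent k := lser fps_X.

Lemma lser_inj : injective lser.
Proof. by move=> a b /eqP; rewrite tofrac_eq => /eqP. Qed.

Lemma lvar_neq0 : lvar != 0.
Proof. by rewrite tofrac_eq0 fps_X_neq0. Qed.

Lemma laurent_frac u : exists a b, b != 0 /\ u = lser a / lser b.
Proof.
elim/quotW: u => x; exists (frac x).1, (frac x).2; have d0 := denom_ratioP x; split=> //.
apply: (mulIf (_ : lser (frac x).2 != 0)); first by rewrite tofrac_eq0.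
rewrite mulfVK ?tofrac_eq0 //= /FracField.tofrac; unlock.
rewrite -[LHS]FracField.pi_mul /FracField.mulf; apply/eqmodP.
by rewrite /= FracField.equivfE !numden_Ratio ?mulr1 ?oner_eq0 // mulrC.
Qed.

(** A denominator is a power of the variable times an invertible series. *)
Lemma laurent_shift u : exists N a, u * lvar ^+ N = lser a.
Proof.
have [a [b [b0 ->]]] := laurent_frac u.
have [m [c [-> /fps_unit[d cd]]]] := fps_valuation b0.
exists m, (a * d); rewrite !rmorphM rmorphXn -/lvar.
have -> : lser d = (lser c)^-1.
  have Dcd : lser c * lser d = 1 by rewrite -rmorphM cd rmorph1.
  have c0 : lser c != 0 by apply: contra_eq_neq Dcd => ->; rewrite mul0r eq_sym oner_neq0.
  by apply: (mulfI c0); rewrite Dcd divff.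
rewrite [_ * lser c]mulrC invfM mulrA mulfVK //.
by rewrite expf_neq0 ?lvar_neq0.
Qed.

(** With $s = 1/y$ one has $dy = -s^{-2}ds$, so the coefficient of $s^1$ is, up to sign, the residue
    of $u\,dy$. By [resE] it does not depend on the shift [N]. *)
Definition res u : k :=
  let: exist N Ha := cid (laurent_shift u) in
  let: exist a _ := cid Ha in a N.+1.

Lemma resE u N a : u * lvar ^+ N = lser a -> res u = a N.+1.
Proof.
move=> Da; rewrite /res; case: cid => M HM; case: cid => b Db.
have : fps_X ^+ M * a = fps_X ^+ N * b.
  apply: lser_inj; rewrite !rmorphM !rmorphXn -Da -Db -/lvar.
  by rewrite mulrCA [RHS]mulrCA [lvar ^+ M * _]mulrC.
move/(congr1 (fun c => fcoef c (M + N).+1)); rewrite !fps_XnME.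
have -> : ((M + N).+1 < M)%N = false by lia.
have -> : ((M + N).+1 < N)%N = false by lia.
have -> : ((M + N).+1 - M = N.+1)%N by lia.
by have -> : ((M + N).+1 - N = M.+1)%N by lia.
Qed.

Lemma res_lser a : res (lser a) = a 1%N.
Proof. by apply: resE; rewrite mulr1. Qed.

Lemma res_lser_lvar2 a : res (lvar ^+ 2 * lser a) = 0.
Proof. by rewrite -rmorphXn -rmorphM res_lser fps_XnME. Qed.

Lemma resD u v : res (u + v) = res u + res v.
Proof.
have [[N [a Da]] [M [b Db]]] := (laurent_shift u, laurent_shift v).
have Da' : u * lvar ^+ (N + M) = lser (fps_X ^+ M * a).
  by rewrite exprD mulrA Da mulrC rmorphM rmorphXn.
have Db' : v * lvar ^+ (N + M) = lser (fps_X ^+ N * b).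
  by rewrite addnC exprD mulrA Db mulrC rmorphM rmorphXn.
rewrite (resE Da') (resE Db') -fps_addE; apply: resE.
by rewrite mulrDl Da' Db' rmorphD.
Qed.

Lemma resZ x u : res (lconst x * u) = x * res u.
Proof.
have [N [a Da]] := laurent_shift u.
rewrite (resE Da) -fps_constME; apply: resE.
by rewrite -mulrA Da rmorphM.
Qed.

Lemma res0 : res 0 = 0.
Proof. by rewrite -(rmorph0 lser) res_lser fps_zeroE. Qed.

Lemma res_sum (I : Type) (r : seq I) (P : pred I) (f : I -> laurent k) :
  res (\sum_(i <- r | P i) f i) = \sum_(i <- r | P i) res (f i).
Proof. exact: (big_morph res resD res0). Qed.

Lemma res_lvarV n : res (lvar^-1 ^+ n) = 0.
Proof.
rewrite (@resE _ n 1) ?fps_oneE //.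
by rewrite -exprMn mulVf ?lvar_neq0 // expr1n rmorph1.
Qed.

(** A polynomial in $y = 1/s$ has no positive power of $s$. The residue theorem rests on this. *)
Lemma res_peval p : res (peval lconst lvar^-1 p) = 0.
Proof.
rewrite pevalE horner_coef res_sum big1 // => i _.
by rewrite coef_map resZ res_lvarV mulr0.
Qed.

End Laurent.

Arguments lvar {k}.

(** * Places and integrality *)

Section AvoidingValuationRing.
Variable K : fieldType.
Implicit Types (B : K -> Prop) (u h : K).

Definition subring_set B :=
  [/\ B 1, forall a b, B a -> B b -> B (a - b) & forall a b, B a -> B b -> B (a * b)].

Lemma subring_set0 B : subring_set B -> B 0.
Proof. by case=> B1 BB _; rewrite -(subrr 1); apply: (BB). Qed.

Lemma subring_setD B a b : subring_set B -> B a -> B b -> B (a + b).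
Proof.
move=> sB Ba Bb; have [_ BB _] := sB; rewrite -[b]opprK -[- b]sub0r.
by apply: (BB) => //; apply: (BB) => //; exact: subring_set0.
Qed.

Lemma subring_set_sum B (I : Type) (r : seq I) (P : pred I) (F : I -> K) :
  subring_set B -> (forall i, P i -> B (F i)) -> B (\sum_(i <- r | P i) F i).
Proof.
move=> sB BF; elim/big_ind: _ => //; first exact: subring_set0.
by move=> a b; apply: subring_setD.
Qed.

Section Maximal.
Variables (B : K -> Prop) (h : K).
Hypotheses (sB : subring_set B) (BhV : B h^-1) (Bh : ~ B h).
Hypothesis maxB : forall B', subring_set B' -> (forall a, B a -> B' a) -> ~ B' h ->
  forall a, B' a -> B a.

Let h_neq0 : h != 0.
Proof. by apply: contra_not_neq Bh => ->; exact: subring_set0. Qed.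

(** The fractions $a/(1 - c/h)$ form a ring containing [B] that still avoids [h], because $h = a/(1
    - c/h)$ means $h = a + c$. By maximality this ring is [B]. *)
Lemma avoiding_unit b : B b -> B (1 - b / h)^-1.
Proof.
have [B1 BB BM] := sB.
have den0 c : B c -> 1 - c / h != 0.
  move=> Bc; rewrite subr_eq0; apply: contra_not_neq Bh => D1.
  by rewrite -[h]mul1r D1 mulfVK.
pose B' x := exists a c, [/\ B a, B c & x = a / (1 - c / h)].
move=> Bb; apply: (maxB (B' := B')); last by exists 1, b; rewrite mul1r.
- split.
  + by exists 1, 0; rewrite mul0r subr0 divr1; split=> //; exact: subring_set0.
  + move=> _ _ [a [c [Ba Bc ->]]] [a' [c' [Ba' Bc' ->]]].
    exists (a * (1 - c' / h) - a' * (1 - c / h)), (c + c' - c * c' / h); split.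
    * by apply: (BB); apply: (BM) => //; apply: (BB) => //; apply: (BM).
    * apply: (BB); first exact: subring_setD.
      by apply: (BM) => //; apply: (BM).
    * rewrite -[- (a' / _)]mulNr addf_div ?den0 // mulNr; congr (_ / _).
      by field.
  + move=> _ _ [a [c [Ba Bc ->]]] [a' [c' [Ba' Bc' ->]]].
    exists (a * a'), (c + c' - c * c' / h); split; first exact: BM.
      apply: (BB); first exact: subring_setD.
      by apply: (BM) => //; apply: (BM).
    by rewrite mulf_div; congr (_ / _); field.
- by move=> a Ba; exists a, 0; rewrite mul0r subr0 divr1; split=> //; exact: subring_set0.
move=> [a [c [Ba Bc Dh]]]; apply: Bh; have -> : h = a + c.
  have <- : h * (1 - c / h) = a by rewrite {1}Dh mulfVK ?den0.
  by rewrite mulrBr mulr1 mulrCA divff // mulr1 subrK.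
exact: subring_setD.
Qed.

Let rel u n := exists p : {poly K}, [/\ (size p <= n.+1)%N, forall i, B p`_i & h = p.[u]].

(** Otherwise $B[u]$ would be a strictly larger subring avoiding [h]. *)
Lemma avoiding_adjoin u : ~ B u -> exists n, rel u n.
Proof.
have [B1 BB BM] := sB; have B0 := subring_set0 sB.
move=> Bu; apply: contrapT => no; apply: Bu.
pose B' x := exists p : {poly K}, (forall i, B p`_i) /\ x = p.[u].
apply: (maxB (B' := B')).
- split.
  + by exists 1; split=> [i|]; rewrite ?hornerC // coef1; case: eqP.
  + move=> _ _ [p [Bp ->]] [q [Bq ->]]; exists (p - q).
    by split=> [i|]; rewrite ?hornerE // coefB; apply: (BB).
  + move=> _ _ [p [Bp ->]] [q [Bq ->]]; exists (p * q).
    split=> [i|]; rewrite ?hornerE // coefM.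
    by apply: subring_set_sum => // j _; apply: (BM).
- move=> a Ba; exists a%:P; split=> [i|]; last by rewrite hornerC.
  by rewrite coefC; case: eqP.
- move=> [p [Bp Dh]]; apply: no; exists (size p), p; split=> //.
- by exists 'X; split=> [i|]; rewrite ?hornerX // coefX; case: eqP.
Qed.

(** The relation for $u^{-1}$, solved with the unit $1 - q_0/h$ and multiplied by $u^m$, expresses
    $u^m$ through lower powers with coefficients in [B]; substitution shortens the relation for
    [u]. *)
Lemma avoiding_descent u m n : u != 0 -> rel u m -> rel u^-1 n -> (n <= m)%N ->
  exists2 m', m = m'.+1 & rel u m'.
Proof.
have [B1 BB BM] := sB; have B0 := subring_set0 sB.
move=> u0 [p [szp Bp Dp]] [q [szq Bq Dq]] le_nm.
case: m => [|m] in szp le_nm *.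
  (* A relation of degree 0 would put [h] itself in [B]. *)
  case: Bh; rewrite Dp (horner_coef_wide _ szp) big_ord1 expr0 mulr1 //.
exists m => //; pose w := (1 - q`_0 / h)^-1.
have Bw : B w by exact: avoiding_unit.
have w0 : 1 - q`_0 / h != 0.
  rewrite subr_eq0; apply: contra_not_neq Bh => D1.
  by rewrite -[h]mul1r D1 mulfVK.
have Dum : u ^+ m.+1 = \sum_(j < n) h^-1 * w * q`_j.+1 * u ^+ (m - j).
  have : h * (1 - q`_0 / h) = \sum_(j < n) q`_j.+1 * u^-1 ^+ j.+1.
    rewrite mulrBr mulr1 mulrCA divff // mulr1 {1}Dq (horner_coef_wide _ szq).
    by rewrite big_ord_recl expr0 mulr1 addrC addKr.
  move/(congr1 (fun x => h^-1 * w * x * u ^+ m.+1)).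
  rewrite mulrACA mulVf // [w * _]mulVf // !mul1r => ->.
  rewrite mulr_sumr mulr_suml; apply: eq_bigr => j _.
  rewrite -!mulrA; congr (_ * (_ * (_ * _))).
  have -> : u ^+ m.+1 = u ^+ (j.+1 + (m - j)) by congr (_ ^+ _); have := ltn_ord j; lia.
  by rewrite exprD mulrA -exprMn mulVf // expr1n mul1r.
exists (\sum_(i < m.+1) p`_i *: 'X^i
  + \sum_(j < n) (p`_m.+1 * (h^-1 * w * q`_j.+1)) *: 'X^(m - j)); split.
- rewrite (leq_trans (size_polyD _ _)) // geq_max; apply/andP; split;
  apply: (leq_trans (size_sum _ _ _)); apply/bigmax_leqP => i _;
  rewrite (leq_trans (size_scale_leq _ _)) // size_polyXn // ltnS leq_subr //.
- move=> i; rewrite coefD !coef_sum; apply: subring_setD => //; apply: subring_set_sum => // j _;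
  rewrite coefZ coefXn; apply: (BM) => //; do ?[by case: eqP];
  by do ?[apply: (BM) => //].
rewrite hornerD !horner_sum {1}Dp (horner_coef_wide _ szp) big_ord_recr /=; congr (_ + _).
  by apply: eq_bigr => i _; rewrite hornerZ hornerXn.
rewrite Dum mulr_sumr; apply: eq_bigr => j _.
by rewrite hornerZ hornerXn !mulrA.
Qed.

(** If both failed, there would be relations for [u] and for $u^{-1}$, and the longer of the two
    could be shortened forever. *)
Lemma avoiding_valuation u : u != 0 -> B u \/ B u^-1.
Proof.
move=> u0; apply: contrapT => /not_orP[Bu BuV].
have [[m rm] [n rn]] := (avoiding_adjoin Bu, avoiding_adjoin BuV).
have [N] := ubnP (m + n); elim: N u m n u0 rm rn {Bu BuV} => // N IHN u m n u0 rm rn.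
case: (leqP n m) => [le_nm | /ltnW le_mn]; rewrite ltnS => lt_N.
  have [m' Dm rm'] := avoiding_descent u0 rm rn le_nm.
  by apply: (IHN _ _ _ u0 rm' rn); rewrite Dm in lt_N.
have uV0 : u^-1 != 0 by rewrite invr_eq0.
have [|n' Dn rn'] := avoiding_descent uV0 rn _ le_mn; first by rewrite invrK.
by apply: (IHN _ _ _ u0 rm rn'); rewrite Dn addnS in lt_N.
Qed.

End Maximal.

Lemma avoiding_valuation_ring B0 h : subring_set B0 -> B0 h^-1 -> ~ B0 h ->
  exists B, [/\ subring_set B, forall a, B0 a -> B a, ~ B h
              & forall a, a != 0 -> B a \/ B a^-1].
Proof.
move=> sB0 B0hV B0h.
pose good (B : set K) := [/\ subring_set B, (B0 `<=` B)%classic & ~ B h].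
have [|B [PB maxB]] := @Zorn_bigcup K (fun B => B = set0 \/ good B).
  move=> F FP totF.
  have goodF X a : F X -> X a -> good X.
    by move=> FX Xa; case: (FP X FX) => // X0; rewrite X0 in Xa.
  case: (pselect (exists X a, F X /\ X a)) => [[X [a [FX Xa]]]|no]; [right|left]; last first.
    apply/seteqP; split=> a //; case=> X FX Xa; apply: no; by exists X, a.
  have [[X1 XB XM] B0X Xh] := goodF X a FX Xa.
  have common Y Z b c : F Y -> F Z -> Y b -> Z c -> exists W, [/\ F W, W b & W c].
    by move=> FY FZ Yb Zc; case: (totF Y Z FY FZ) => [/(_ b Yb)|/(_ c Zc)]; [exists Z|exists Y].
  split.
  - split; first by exists X.
    + move=> b c [Y FY Yb] [Z FZ Zc]; have [W [FW Wb Wc]] := common _ _ _ _ FY FZ Yb Zc.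
      by exists W => //; have [[_ WB _] _ _] := goodF W b FW Wb; exact: WB.
    + move=> b c [Y FY Yb] [Z FZ Zc]; have [W [FW Wb Wc]] := common _ _ _ _ FY FZ Yb Zc.
      by exists W => //; have [[_ _ WM] _ _] := goodF W b FW Wb; exact: WM.
  - by move=> b B0b; exists X => //; exact: B0X.
  - by move=> [Y FY Yh]; have [_ _] := goodF Y h FY Yh.
have gB0 : good B0 by split.
have gB : good B.
  case: PB => // B_0; case: (maxB B0); last by right.
  split; first by move=> a; rewrite B_0.
  by move=> /(_ 1); rewrite B_0; apply; case: sB0.
have [sB B0B Bh] := gB; exists B; split=> //.
apply: (@avoiding_valuation B h) => //; first exact: B0B.
move=> B' sB' BB' B'h a B'a; apply: contrapT => Ba.
apply: (maxB B'); last by right; split=> // b /B0B /BB'.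
by split=> // /(_ a B'a).
Qed.

End AvoidingValuationRing.

(** If [h] is not integral over $\mathbb{C}[z]$, then it is not in $\mathbb{C}[z][h^{-1}]$, and a
    valuation ring that contains this ring and avoids [h] is a place with [z] but without [h]. *)
Lemma integral_of_places (K : fieldType) (iota : {rmorphism CC -> K}) (z h : K) :
  (forall O, is_place iota O -> O z -> O h) -> integralOver (peval iota z) h.
Proof.
move=> Oh; apply: contrapT => nint.
have h0 : h != 0.
  by apply: contra_not_neq nint => ->; exact: integral0.
pose B0 (x : K) := exists p : {poly {poly CC}}, x = (map_poly (peval iota z) p).[h^-1].
have sB0 : subring_set B0.
  split; first by exists 1; rewrite rmorph1 hornerC.
    by move=> _ _ [p ->] [q ->]; exists (p - q); rewrite rmorphB !hornerE.
  by move=> _ _ [p ->] [q ->]; exists (p * q); rewrite rmorphM !hornerE.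
have B0h : ~ B0 h.
  (* Multiplying $h = p(h^{-1})$ by $h^N$ gives a monic equation of degree [N + 1]. *)
  move=> [p Dh]; apply: nint; set f := peval iota z in Dh *.
  pose N := size p; exists ('X^(N.+1) - \sum_(i < N) p`_i *: 'X^(N - i)).
    rewrite monicE lead_coefDl ?lead_coefXn // size_polyN size_polyXn ltnS.
    apply: (leq_trans (size_sum _ _ _)); apply/bigmax_leqP => i _.
    by rewrite (leq_trans (size_scale_leq _ _)) // size_polyXn ltnS leq_subr.
  rewrite /root rmorphB raddf_sum /= map_polyXn hornerD hornerN hornerXn horner_sum.
  have szp : (size (map_poly f p) <= N)%N by exact: size_poly.
  rewrite exprSr {2}Dh (horner_coef_wide _ szp) mulr_sumr -sumrB big1 // => i _.
  rewrite map_polyZ /= map_polyXn hornerZ hornerXn coef_map.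
  have -> : h ^+ N = h ^+ (i + (N - i)) by congr (_ ^+ _); have := ltn_ord i; lia.
  by rewrite mulrCA exprD mulrAC -exprMn divff // expr1n mul1r subrr.
have [|B [sB B0B Bh valB]] := avoiding_valuation_ring sB0 _ B0h.
  by exists 'X; rewrite map_polyX hornerX.
have [B1 BB BM] := sB.
apply: (Bh); apply: Oh.
  split=> //; first by split=> //; exact: subring_set0.
    by move=> c; apply: B0B; exists c%:P%:P; rewrite map_polyC hornerC /= pevalC.
  by split=> //; exists h.
by apply: B0B; exists ('X%:P); rewrite map_polyC hornerC /= pevalX.
Qed.

(** * Power sums and factorization *)

Section PowerSums.
Variables (R F : comNzRingType) (iota : {rmorphism R -> F}) (I : finType) (r : I -> F).
Variable g : {poly R}.
Hypothesis Dg : map_poly iota g = \prod_i ('X - (r i)%:P).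

Lemma deriv_prod_XsubC (s : seq I) : uniq s ->
  (\prod_(i <- s) ('X - (r i)%:P))^`() =
  \sum_(i <- s) \prod_(j <- s | j != i) ('X - (r j)%:P).
Proof.
elim: s => [|i s IHs] /=; first by rewrite !big_nil derivC.
case/andP=> i_s /IHs IH; rewrite !big_cons eqxx derivM derivXsubC mul1r IH mulr_sumr.
congr (_ + _).
  rewrite big_seq [RHS]big_seq_cond; apply: eq_bigl => j.
  by case: eqP => [->|]; rewrite ?(negPf i_s) ?andbT.
rewrite big_seq [RHS]big_seq; apply: eq_bigr => j js; rewrite big_cons ifT //.
by apply: contraNneq i_s => ->.
Qed.

(* Newton's recursion: with [f = \prod_i (X - r_i)], multiplying
   [\sum_i r_i^n f / (X - r_i)] by [X] raises [n], up to [p_n f], where the power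
   sum [p_n] is the leading coefficient. *)
Lemma power_sum n : exists q, \sum_i r i ^+ n = iota q.
Proof.
have [I0|/card_gt0P[i0 _]] := posnP #|I|.
  by exists 0; rewrite big1 ?rmorph0 // => i; have := card0_eq I0 i; rewrite inE.
pose Q i := \prod_(j | j != i) ('X - (r j)%:P).
have QE i : ('X - (r i)%:P) * Q i = map_poly iota g by rewrite Dg (bigD1 i).
have szQ i : size (Q i) = #|I|.
  rewrite /Q -big_filter size_prod_XsubC size_filter cardT enumT.
  rewrite -[in RHS](count_predC (pred1 i)) count_uniq_mem ?index_enum_uniq //.
  by rewrite mem_index_enum.
have leadQ i : (Q i)`_(#|I|.-1) = 1.
  by rewrite -(szQ i); apply/eqP/monic_prod_XsubC.
have lift m : exists H : {poly R}, \sum_i r i ^+ m *: Q i = map_poly iota H.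
  elim: m => [|m [H DH]].
    exists g^`(); rewrite -deriv_map Dg.
    rewrite deriv_prod_XsubC ?index_enum_uniq //.
    by apply: eq_bigr => i _; rewrite expr0 scale1r.
  exists ('X * H - H`_(#|I|.-1) *: g).
  rewrite rmorphB rmorphM /= map_polyX map_polyZ -DH mulr_sumr.
  rewrite -coef_map -DH coef_sum.
  have -> : \sum_i (r i ^+ m *: Q i)`_(#|I|.-1) = \sum_i r i ^+ m.
    by apply: eq_bigr => i _; rewrite coefZ leadQ mulr1.
  rewrite scaler_suml -sumrB; apply: eq_bigr => i _.
  rewrite -(QE i) -scalerAr -scalerBr mulrBl opprB addrC subrK mul_polyC.
  by rewrite scalerA -exprSr.
have [H DH] := lift n; exists (H`_(#|I|.-1)); rewrite -coef_map -DH coef_sum.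
by apply: eq_bigr => i _; rewrite coefZ leadQ mulr1.
Qed.

(** The sum is the trace of [N] modulo [g]; expanding [N] reduces it to power sums of the roots. *)
Lemma horner_sum_roots (N : {poly R}) : exists q, \sum_i (map_poly iota N).[r i] = iota q.
Proof.
have /choice[p pE] := power_sum.
exists (\sum_(j < size N) N`_j * p j).
under eq_bigr do rewrite (horner_coef_wide _ (size_poly _ _)).
rewrite exchange_big rmorph_sum; apply: eq_bigr => j _.
by rewrite rmorphM -pE mulr_sumr; apply: eq_bigr => i _; rewrite coef_map.
Qed.

End PowerSums.

(** A count of roots: each factor has at least as large a degree as its number of roots in [rs],
    every member of [rs] is a root of one of them, and the degrees add up to the size of [rs]. *)
Lemma split_factor_roots (F : fieldType) (p q : {poly F}) (w : F) (rs : seq F) :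
    w != 0 -> uniq rs -> p * q = w *: \prod_(r <- rs) ('X - r%:P) ->
  p = lead_coef p *: \prod_(r <- rs | root p r) ('X - r%:P).
Proof.
move=> w0 uniq_rs Dpq.
have pq0 : p * q != 0.
  by rewrite Dpq scaler_eq0 negb_or w0 monic_neq0 // monic_prod_XsubC.
have /andP[p0 q0] : (p != 0) && (q != 0) by rewrite -negb_or -mulf_eq0.
rewrite -big_filter; set ps := filter _ _.
apply: all_roots_prod_XsubC; rewrite ?uniq_rootsE ?filter_uniq ?filter_all //.
pose qs := filter (root q) rs.
have le_p : (size ps < size p)%N.
  by apply: max_poly_roots; rewrite ?filter_uniq ?filter_all.
have le_q : (size qs < size q)%N.
  by apply: max_poly_roots; rewrite ?filter_uniq ?filter_all.
have sz_pq : (size p + size q).-1 = (size rs).+1.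
  by rewrite -size_mul // Dpq size_scale // size_prod_XsubC.
have : (size rs <= size ps + size qs)%N.
  rewrite !size_filter -count_predUI (leq_trans _ (leq_addr _ _)) //.
  rewrite -[X in (X <= _)%N](count_predT) -size_filter; apply: eq_leq.
  rewrite size_filter; apply: eq_in_count => r r_rs /=.
  by rewrite -rootM Dpq rootZ // root_prod_XsubC r_rs.
have arith (a b c d n : nat) :
    (c < a -> d < b -> (a + b).-1 = n.+1 -> n <= c + d -> a = c.+1)%N by lia.
exact: (arith _ _ _ _ _ le_p le_q sz_pq).
Qed.

(** The polynomial splits over [CC], so one of its linear factors vanishes at [u]. *)
Lemma closed_root_const (K : fieldType) (iota : {rmorphism CC -> K}) (p : {poly CC}) u :
  p != 0 -> (map_poly iota p).[u] = 0 -> exists a, u = iota a.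
Proof.
move=> p0; have [rs Dp] := closed_field_poly_normal p.
rewrite Dp map_polyZ hornerZ rmorph_prod horner_prod => /eqP.
rewrite mulf_eq0 fmorph_eq0 lead_coef_eq0 (negPf p0) /= => /eqP.
elim: rs {Dp} => [|a rs IHrs]; first by rewrite big_nil => /eqP; rewrite oner_eq0.
rewrite big_cons => /eqP; rewrite mulf_eq0 => /orP[/eqP|/eqP //].
by rewrite rmorphB /= map_polyX map_polyC !hornerE => /eqP; rewrite subr_eq0 => /eqP ->; exists a.
Qed.

(** * Gauss's lemma and kernels of evaluations *)

Section Kernel.

Lemma polyC_factor (g : bipoly) (a : CC) : map_poly (horner_eval a) g = 0 ->
  exists g' : bipoly, g = ('X - a%:P) *: g'.
Proof.
move=> ga; exists (\poly_(i < size g) (g`_i %/ ('X - a%:P))).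
apply/polyP => i; rewrite coefZ coef_poly.
case: ltnP => [_|/(nth_default 0) -> //]; last by rewrite mulr0.
rewrite mulrC divpK // dvdp_XsubCl /root.
by have := congr1 (fun p : {poly CC} => p`_i) ga; rewrite coef_map coef0 => /eqP.
Qed.

(** Induction on the degree of [c]: a linear factor $x - a$ of [c] is prime in $\mathbb{C}[x][y]$,
    hence divides [q] or [g] and can be cancelled there without changing the degree in $y$. *)
Lemma gauss_factor (c : {poly CC}) (f q g : bipoly) : c != 0 -> c *: f = q * g ->
  exists q' g' : bipoly, f = q' * g' /\ size g' = size g.
Proof.
have [n] := ubnP (size c); elim: n c q g => // n IHn c q g lt_cn c0 Dcf.
case: (boolP (size c == 1%N)) => [/size_poly1P[l l0 Dc]|].
  exists (l^-1%:P *: q), g; split=> //.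
  by rewrite -scalerAl -Dcf Dc scalerA -polyCM mulVf // scale1r.
case/closed_rootP => a; rewrite root_factor_theorem => /dvdpP[c' Dc].
have c'0 : c' != 0 by apply: contraNneq c0 => c'0; rewrite Dc c'0 mul0r.
have lt_c' : (size c' < n)%N.
  by move: lt_cn; rewrite Dc size_mul ?polyXsubC_eq0 // size_XsubC addn2.
have Xa0 : ('X - a%:P : {poly CC}) != 0 by rewrite polyXsubC_eq0.
have scaleI (u v : bipoly) : ('X - a%:P) *: u = ('X - a%:P) *: v -> u = v.
  by rewrite -!mul_polyC; apply: mulfI; rewrite polyC_eq0.
have : map_poly (horner_eval a) q * map_poly (horner_eval a) g = 0.
  rewrite -rmorphM /= -Dcf map_polyZ /= Dc /horner_eval hornerM hornerXsubC subrr mulr0 scale0r //.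
move/eqP; rewrite mulf_eq0 => /orP[]/eqP/polyC_factor[h Dh].
  apply: (IHn c' h g) => //; apply: scaleI.
  by rewrite scalerA mulrC -Dc Dcf Dh scalerAl.
have [|q' [g' [Df szg']]] := IHn c' q h lt_c' c'0.
  by apply: scaleI; rewrite scalerA mulrC -Dc Dcf Dh scalerAr.
by exists q', g'; rewrite szg' Dh -mul_polyC size_Cmul.
Qed.

(** Let [g] have least degree in $y$ in the kernel. Pseudo-division and Gauss's lemma give a factor
    of [f] of the same degree, so by irreducibility [f] has least degree too. As its leading
    coefficient is a unit, division by [f] leaves remainder 0 on the kernel. *)
Lemma kernel_irreducible (F : idomainType) (e : {rmorphism bipoly -> F}) (f : bipoly) (l : CC) :
    birreducible f -> lead_coef f = l%:P -> e f = 0 ->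
    (forall p : {poly CC}, e p%:P = 0 -> p = 0) ->
  forall h, e h = 0 <-> bdvd f h.
Proof.
move=> [f0 [_ irr_f]] lead_f ef0 inj_e.
have l0 : l != 0 by rewrite -(polyC_eq0 l) -lead_f lead_coef_eq0.
pose P n := `[< exists g : bipoly, [/\ g != 0, e g = 0 & size g = n] >].
have exP : exists n, P n by exists (size f); apply/asboolP; exists f.
case: (ex_minnP exP) => n /asboolP[g [g0 eg0 Dn]] min_n.
have modg h : e h = 0 -> (size h < n)%N -> h = 0.
  move=> eh0; apply: contraTeq => h0; rewrite -leqNgt; apply: min_n.
  by apply/asboolP; exists h.
have szg : size g != 1%N.
  apply/negP => /size_poly1P[c c0 Dc]; case/eqP: c0; apply: inj_e.
  by rewrite -Dc.
have mod0 h : e h = 0 -> h %% g = 0.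
  move=> eh0; apply: modg; last by rewrite -Dn ltn_modp.
  have := congr1 e (Pdiv.Idomain.divp_eq h g).
  by rewrite rmorphD -mul_polyC !rmorphM eh0 eg0 !mulr0 add0r => <-.
have := Pdiv.Idomain.divp_eq f g; rewrite mod0 // addr0 => /gauss_factor[].
  by rewrite expf_neq0 // lead_coef_eq0.
move=> q [g' [Df szg']].
have [g'0 q0] : g' != 0 /\ q != 0.
  by move: f0; rewrite Df mulf_eq0 negb_or => /andP[].
have szf : size f = n.
  have [uq|ug] := irr_f _ _ Df.
    rewrite Df size_mul // szg' Dn.
    by move: uq; rewrite poly_unitE => /andP[/eqP -> _].
  by move: ug szg; rewrite poly_unitE -szg' => /andP[-> _].
move=> h; split=> [eh0|[q' ->]]; last by rewrite rmorphM ef0 mul0r.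
have uf : lead_coef f \is a GRing.unit by rewrite lead_f poly_unitE size_polyC l0 coefC eqxx unitfE.
have Dh := Pdiv.IdomainUnit.divp_eq uf h.
exists (h %/ f); rewrite mulrC {1}Dh (modg (h %% f)) ?addr0 //; last first.
  by rewrite -szf ltn_modp.
by move/(congr1 e): Dh; rewrite rmorphD rmorphM ef0 mulr0 add0r eh0 => <-.
Qed.

End Kernel.

(** * Traces of integral elements *)

Lemma rmorph_poly_horner (R S : comNzRingType) (e : {rmorphism {poly R} -> S}) N :
  e N = (map_poly (e \o polyC) N).[e 'X].
Proof.
elim/poly_ind: N => [|N c IHN]; first by rewrite !rmorph0 horner0.
by rewrite !rmorphD !rmorphM /= IHN map_polyX map_polyC !hornerE.
Qed.

Lemma eq_integralOver (R K : nzRingType) (f g : R -> K) (x : K) :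
  f =1 g -> integralOver f x -> integralOver g x.
Proof. by move=> fg [p p_monic]; rewrite (eq_map_poly fg); exists p. Qed.

Lemma peval_inj (K : fieldType) (iota : {rmorphism CC -> K}) (u : K) :
  (forall a, u != iota a) -> forall p, peval iota u p = 0 -> p = 0.
Proof.
move=> u_nconst p pu0; apply/eqP; apply: contrapT => /negP p0.
by have [a /eqP] := closed_root_const p0 pu0; apply/negP.
Qed.

Lemma lvarV_nconst (k : fieldType) (a : k) : (lvar^-1 : laurent k) != lconst k a.
Proof.
apply/eqP => Da; have /lser_inj : lser k 1 = lser k (fps_const a * fps_X).
  by rewrite rmorphM -/lvar -[lser k (fps_const a)]/(lconst k a) -Da mulVf ?lvar_neq0 ?rmorph1.
by move/(congr1 fps_ct)/eqP; rewrite fps_ctM fps_ctX mulr0 rmorph1 oner_eq0.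
Qed.

(** $\mathbb{C}[u]$ is integrally closed: in lowest terms, a root of the denominator would also be a
    root of the numerator. *)
Lemma integral_peval_closed (K : fieldType) (iota : {rmorphism CC -> K}) (u Z : K) (r q : {poly CC}) :
    (forall a, u != iota a) -> r != 0 -> peval iota u r * Z = peval iota u q ->
    integralOver (peval iota u) Z ->
  exists q', Z = peval iota u q'.
Proof.
move=> u_nconst r0 Drq [p p_monic pZ0].
set e := peval iota u in Drq pZ0 *.
have inj_e := peval_inj u_nconst.
pose d := gcdp r q; pose r1 := r %/ d; pose q1 := q %/ d.
have d0 : d != 0 by rewrite gcdp_eq0 (negPf r0).
have Dr : r = r1 * d by rewrite divpK ?dvdp_gcdl.
have Dq : q = q1 * d by rewrite divpK ?dvdp_gcdr.
have cop : coprimep r1 q1 by apply: coprimep_div_gcd; rewrite r0.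
have ed0 : e d != 0 by apply: contra_neq d0 => /inj_e.
have Dr1 : e r1 * Z = e q1.
  apply: (mulIf ed0); rewrite -[RHS]rmorphM -Dq -Drq mulrAC -rmorphM.
  by rewrite -Dr.
pose m := (size p).-1.
have szp : size p = m.+1 by rewrite /m prednK // size_poly_gt0 monic_neq0.
(* The integral equation with denominators cleared; every term except the leading one contains a
   factor [r1]. *)
have rel : \sum_(j < m.+1) p`_j * (q1 ^+ j * r1 ^+ (m - j)) = 0.
  apply: inj_e; rewrite rmorph_sum /=.
  transitivity (e r1 ^+ m * (map_poly e p).[Z]); last by rewrite (rootP pZ0) mulr0.
  have szm : (size (map_poly e p) <= m.+1)%N by rewrite -szp; exact: size_poly.
  rewrite (horner_coef_wide _ szm) mulr_sumr; apply: eq_bigr => j _.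
  rewrite coef_map !rmorphM !rmorphXn -Dr1 exprMn /=.
  have -> : e r1 ^+ m = e r1 ^+ (j + (m - j)) by congr (_ ^+ _); have := ltn_ord j; lia.
  by rewrite exprD; ring.
have [sz1 | ] := boolP (size r1 == 1%N); last first.
  case/closed_rootP => a r1a; case/negP: (oner_neq0 CC); move: cop.
  have q1a : root q1 a.
    have := congr1 (fun p => p.[a]) rel; rewrite horner_sum horner0 big_ord_recr /=.
    rewrite big1 ?add0r => [|j _].
      rewrite subnn expr0 mulr1 -lead_coefE (monicP p_monic) mul1r horner_exp => /eqP.
      by rewrite expf_eq0 => /andP[].
    rewrite !hornerM !horner_exp (rootP r1a) expr0n subn_eq0 leqNgt ltn_ord.
    by rewrite !mulr0.
  by move=> /coprimepP/(_ ('X - a%:P)); rewrite !dvdp_XsubCl r1a q1a => /(_ isT isT); rewrite -size_poly_eq1 size_XsubC.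
have [c c0 Dc] := size_poly1P _ sz1.
exists (c^-1%:P * q1); rewrite rmorphM -Dr1 mulrA -rmorphM Dc -polyCM mulVf //.
by rewrite rmorph1 mul1r.
Qed.

Section TraceResidue.
Variables (K : fieldType) (psi : {rmorphism bipoly -> K}) (I : finType).
Variables (sigma : I -> {rmorphism K -> laurent CC}) (g : bipoly) (l : CC).
Hypothesis fracK : forall u, exists a b, psi b != 0 /\ u = psi a / psi b.
Hypotheses (l0 : l != 0) (lead_g : lead_coef g = l%:P) (psi_g : psi g = 0).
Notation ev := (peval (lconst CC) lvar^-1).
Hypothesis sigmaC : forall i p, sigma i (psi p%:P) = ev p.
Variable rho : I -> laurent CC.
Hypothesis sigmaX : forall i, sigma i (psi 'X) = rho i.
Hypothesis Dg : map_poly ev g = lconst CC l *: \prod_i ('X - (rho i)%:P).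

Let iotaK : {rmorphism {poly CC} -> K} := psi \o polyC.

Lemma integral_psi h : integralOver iotaK (psi h).
Proof.
rewrite rmorph_poly_horner; apply: integral_horner.
  by apply/integral_poly => i; rewrite coef_map; exact: integral_id.
exists (l^-1%:P *: g).
  by rewrite monicE lead_coefZ lead_g -polyCM mulVf.
apply/rootP; rewrite map_polyZ hornerZ.
by rewrite -[_.[psi 'X]](rmorph_poly_horner psi g) psi_g mulr0.
Qed.

(** The denominator can be taken in the coefficient ring: once all factors [psi h] are removed from
    an equation of [psi h], its constant coefficient is nonzero and a multiple of [psi h]. *)
Lemma denominator_clear b : (exists i : I, true) ->
  exists N r, r != 0 /\ psi r%:P * b = psi N.
Proof.
case=> i0 _.
have inj_iotaK r : iotaK r = 0 -> r = 0.
  move=> r0; apply: (peval_inj (@lvarV_nconst CC)).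
  by rewrite -(sigmaC i0) [psi _]r0 rmorph0.
have [a [h [h0 ->]]] := fracK b.
have [A [r [r0 Dr]]] : exists A r, r != 0 /\ psi h * psi A = psi r%:P.
  have [p p_monic /rootP] := integral_psi h.
  have {p_monic} := monic_neq0 p_monic.
  have [n] := ubnP (size p); elim: n p => // n IHn p lt_pn p0 ph.
  pose p' := \poly_(i < (size p).-1) p`_i.+1.
  have Dp : p = p' * 'X + (p`_0)%:P.
    apply/polyP => i; rewrite coefD coefMX coefC coef_poly.
    case: i => [|i] /=; first by rewrite add0r.
    rewrite addr0; case: ltnP => // le_pi; rewrite nth_default //.
    by move: le_pi; case: (size p).
  have ph' : (map_poly iotaK p').[psi h] * psi h + iotaK p`_0 = 0.
    by move: ph; rewrite {1}Dp rmorphD rmorphM /= map_polyX map_polyC !hornerE.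
  have [c0 | c0] := eqVneq p`_0 0.
    apply: (IHn p').
    - rewrite (leq_ltn_trans (size_poly _ _)) // -ltnS prednK // size_poly_gt0 //.
    - by apply: contraNneq p0 => p'0; rewrite Dp p'0 c0 mul0r addr0.
    - by move: ph'; rewrite c0 rmorph0 addr0 => /eqP; rewrite mulf_eq0 (negPf h0) orbF => /eqP.
  exists (- (map_poly polyC p').[h]), p`_0; split=> //.
  rewrite rmorphN -horner_map -map_poly_comp mulrN mulrC.
  by apply/eqP; rewrite eq_sym -addr_eq0 addrC; apply/eqP.
exists (a * A), r; split=> //.
by rewrite -Dr mulrC -mulrA mulKf // rmorphM.
Qed.

(** The sum is the trace of [b]. It is a rational function of $1/s$ because [r] times it is a
    symmetric function of the roots, and it is integral over the polynomials in $1/s$; hence it is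
    such a polynomial. *)
Lemma res_trace_integral b : integralOver iotaK b -> res (\sum_i sigma i b) = 0.
Proof.
move=> int_b.
have [I0|/card_gt0P[i0 _]] := posnP #|I|.
  by rewrite big1 ?res0 // => i; have := card0_eq I0 i; rewrite inE.
have [N [r [r0 Dr]]] := denominator_clear b (ex_intro _ i0 isT).
have DgI : map_poly ev (l^-1%:P *: g) = \prod_i ('X - (rho i)%:P).
  by rewrite map_polyZ /= Dg scalerA pevalC -rmorphM mulVf // rmorph1 scale1r.
have [q Dq] := horner_sum_roots DgI N.
have [q' ->] : exists q', \sum_i sigma i b = ev q'.
  apply: (integral_peval_closed (@lvarV_nconst CC) r0 (q := q)).
    rewrite -Dq mulr_sumr; apply: eq_bigr => i _.
    rewrite -(sigmaC i) -rmorphM Dr.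
    rewrite -[LHS]/((sigma i \o psi) N) rmorph_poly_horner /=.
    by rewrite sigmaX; congr (_.[_]); apply: eq_map_poly => p /=; exact: sigmaC.
  elim/big_ind: _ => [|u v|i _]; [exact: integral0 | exact: integral_add |].
  apply: eq_integralOver (integral_rmorph (sigma i) int_b) => p /=.
  exact: sigmaC.
exact: res_peval.
Qed.

End TraceResidue.

(** * Local residues at infinity *)

Lemma binomial_first_order (R : comNzRingType) (a x b : R) j :
  exists g, (a + x * b) ^+ j.+1 = a ^+ j.+1 + x * (j.+1%:R * a ^+ j * b + x * g).
Proof.
elim: j => [|j [g IHj]]; first by exists 0; ring.
exists (g * a + b * (j.+1%:R * a ^+ j * b + x * g)).
by rewrite exprSr IHj !exprS -[j.+2%:R]natr1; ring.
Qed.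

(* At a point at infinity with [x = xi], [y = 1 / s], where
   [xi = c / s + e s^m + O(s^(m+1))], the form [b (x dy - y dx)] has residue
   [res (b xi) - res (psi (b / s))]: the morphism [psi] reexpands series in powers
   of [1 / xi], which turns [res] into the residue of [_ * dx]. *)
Section LocalResidue.
Variables (k : fieldType) (c : k) (m : nat) (w E : fps k).
Hypotheses (c0 : c != 0) (m2 : (2 < m)%N).
Hypothesis Dw : w = fps_const c + fps_X ^+ m.+1 * E.
Let xi : laurent k := lser k w / lvar.
Variable psi : {rmorphism laurent k -> laurent k}.
Hypotheses (psiC : forall x, psi (lconst k x) = lconst k x) (psi_xi : psi xi = lvar^-1).
Hypothesis psi_lser : forall a, exists a', psi (lser k a) = lser k a' /\ fps_ct a' = fps_ct a.

Let ctw : fps_ct w = c.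
Proof. by rewrite Dw fps_ctD fps_ctM fps_ct_const exprS fps_ctM fps_ctX !mul0r addr0. Qed.

Let lw_neq0 : lser k w != 0.
Proof.
apply: contra_neq c0 => w0; rewrite -ctw.
have -> : w = 0 by apply: (@lser_inj k); rewrite w0 rmorph0.
exact: rmorph0.
Qed.

(** Inverting $x = y(c + Ey^{-m-1})$ gives $y = x(c^{-1} + Tx^{-m-1})$; after [psi] the variable
    stands for $1/x$. *)
Let psi_lvar_ex : exists theta, [/\ psi lvar^-1 = lvar^-1 * lser k theta, fps_ct theta != 0
  & exists T, theta = fps_const c^-1 + fps_X ^+ m.+1 * T /\ fps_ct T = - (c ^+ m / c) * fps_ct E].
Proof.
have [w' [Dw' ctw']] := psi_lser w; rewrite ctw in ctw'.
have [E' [DE' ctE']] := psi_lser E.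
have lx : lvar = lser k w / xi :> laurent k by rewrite /xi invf_div mulrCA divff ?mulr1.
have psi_lvar : psi lvar = lser k (fps_X * w').
  by rewrite lx rmorphM fmorphV psi_xi invrK Dw' rmorphM mulrC.
have [theta wt] : exists theta, w' * theta = 1 by apply: fps_unit; rewrite ctw'.
have Dw'E : w' = fps_const c + (fps_X * w') ^+ m.+1 * E'.
  apply: (@lser_inj k); rewrite -Dw' Dw rmorphD rmorphM rmorphXn !rmorphD !rmorphM /=.
  by rewrite [psi (lser k (fps_const c))]psiC DE' rmorphXn -/lvar psi_lvar !rmorphXn.
exists theta; split.
- have Dt : lser k theta = (lser k w')^-1.
    have w'0 : lser k w' != 0 by rewrite -Dw' fmorph_eq0.
    by apply: (mulfI w'0); rewrite divff // -rmorphM wt rmorph1.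
  by rewrite fmorphV psi_lvar rmorphM invfM Dt.
- by apply: contra_eq_neq (congr1 fps_ct wt) => t0; rewrite fps_ctM t0 mulr0 eq_sym oner_neq0.
have Dtheta : theta = fps_const c^-1 - fps_const c^-1 * ((fps_X * w') ^+ m.+1 * E') * theta.
  have : fps_const c^-1 * (w' * theta) = fps_const c^-1 by rewrite wt mulr1.
  rewrite {1}Dw'E mulrDl mulrDr [_ * (fps_const c * _)]mulrA -(rmorphM (@fps_const k)) mulVf // rmorph1 mul1r => D1.
  by rewrite -{1}D1 -[X in _ - X]mulrA addrK.
have ctt : fps_ct theta = c^-1.
  have := congr1 fps_ct wt; rewrite fps_ctM ctw' => ct1.
  by apply: (mulfI c0); rewrite divff // ct1 [fps_ct 1]rmorph1.
exists (- (fps_const c^-1 * w' ^+ m.+1 * E' * theta)); split.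
  by rewrite {1}Dtheta; congr (_ + _); rewrite exprMn; ring.
rewrite [LHS]rmorphN /= !fps_ctM [fps_ct (w' ^+ _)]rmorphXn /= ctw' ctt ctE' fps_ct_const.
by rewrite exprS; field.
Qed.

Let Delta b := res (b * xi) - res (psi (b / lvar)).

Let DeltaD a b : Delta (a + b) = Delta a + Delta b.
Proof. by rewrite /Delta [_ * xi]mulrDl [_ / lvar]mulrDl (rmorphD psi) !resD opprD addrACA. Qed.

Let DeltaZ x b : Delta (lconst k x * b) = x * Delta b.
Proof. by rewrite /Delta -!mulrA rmorphM psiC !resZ mulrBr. Qed.

(** Multiplication by $x$ or $y$ lowers the order by one, and a series of order at least 2 has no
    term in $s^1$. *)
Let Delta_lvar3 a : Delta (lvar ^+ 3 * lser k a) = 0.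
Proof.
have [a' [Da' _]] := psi_lser a.
have [w' [Dw' _]] := psi_lser w.
have lx : lvar = lser k w / xi :> laurent k by rewrite /xi invf_div mulrCA divff ?mulr1.
have psi_lvar : psi lvar = lvar * lser k w'.
  by rewrite {1}lx rmorphM fmorphV psi_xi invrK Dw' mulrC.
have shift1 (F : fieldType) (x u v : F) : x != 0 -> x ^+ 3 * u * (v / x) = x ^+ 2 * (u * v).
  by move=> x0; field.
have shift2 (F : fieldType) (x u : F) : x != 0 -> x ^+ 3 * u / x = x ^+ 2 * u.
  by move=> x0; field.
rewrite /Delta; have -> : lvar ^+ 3 * lser k a * xi = lvar ^+ 2 * lser k (a * w).
  by rewrite /xi rmorphM (shift1 _ _ _ _ (lvar_neq0 k)).
have -> : lvar ^+ 3 * lser k a / lvar = lvar ^+ 2 * lser k a.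
  by rewrite (shift2 _ _ _ (lvar_neq0 k)).
rewrite (rmorphM psi) (rmorphXn psi) psi_lvar Da' exprMn -[X in _ - res X]mulrA.
have -> : lser k w' ^+ 2 * lser k a' = lser k (w' ^+ 2 * a') by rewrite rmorphM rmorphXn.
by rewrite !res_lser_lvar2 subrr.
Qed.

Let xi_neq0 : xi != 0.
Proof. by rewrite mulf_neq0 ?invr_eq0 ?lvar_neq0. Qed.

(** The test element $b = 1/(xy)$ of order 2: $bx = 1/y$ and $by = 1/x$ both become the variable. *)
Let Delta_ord2 : Delta (lvar / xi) = 0.
Proof.
rewrite /Delta mulfVK // [_ / _ / _]mulrAC divff ?lvar_neq0 // mul1r.
by rewrite fmorphV psi_xi invrK subrr.
Qed.

(** The test element $b = 1/x$ of order 1: $bx = 1$, and $by = y/x$ becomes [theta], whose first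
    nonconstant term has degree at least $m + 1$. *)
Let Delta_ord1 : Delta xi^-1 = 0.
Proof.
have [theta [Dt _ [T [DT _]]]] := psi_lvar_ex.
rewrite /Delta mulVf // rmorphM Dt fmorphV psi_xi invrK mulrA divff ?lvar_neq0 // mul1r.
rewrite -(rmorph1 (lser k)) !res_lser fps_oneE DT fps_addE fps_XnME /=.
by rewrite ltnS (ltn_trans _ m2) // addr0 subr0.
Qed.

(** For $b = y^j$ the residues are the coefficients of index $j + 2$ in [w] and in $\theta^{j+1}$.
    They vanish for $j + 2 < m + 1$; for $j = m - 1$ they are $E(0)$ and $-mE(0)$. *)
Let Delta_lvarV j : (j < m)%N ->
  Delta (lvar^-1 ^+ j) = if j == m.-1 then m.+1%:R * fps_ct E else 0.
Proof.
move=> lt_jm.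
have [theta [Dt _ [T [DT ctT]]]] := psi_lvar_ex.
have -> : Delta (lvar^-1 ^+ j) = res (lvar^-1 ^+ j * xi) - res (psi lvar^-1 ^+ j.+1).
  by rewrite /Delta -exprSr rmorphXn.
have -> : res (lvar^-1 ^+ j * xi) = (fps_const c + fps_X ^+ m.+1 * E) j.+2.
  rewrite -Dw; apply: resE.
  by rewrite exprSr mulrACA -exprMn mulVf ?lvar_neq0 // expr1n mul1r mulfVK ?lvar_neq0.
have [G DG] : exists G, theta ^+ j.+1 = fps_const (c^-1 ^+ j.+1)
    + fps_X ^+ m.+1 * (fps_const (j.+1%:R * c^-1 ^+ j) * T + fps_X * G).
  have [G] := binomial_first_order (fps_const c^-1) (fps_X ^+ m.+1) T j.
  rewrite -DT => ->; exists (fps_X ^+ m * G).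
  by rewrite !rmorphM !(rmorphXn (@fps_const k)) rmorph_nat [fps_X * (_ * _)]mulrA -exprS.
have -> : res (psi lvar^-1 ^+ j.+1) = (theta ^+ j.+1) j.+2.
  apply: resE; rewrite Dt exprMn mulrAC -exprMn mulVf ?lvar_neq0 // expr1n mul1r.
  by rewrite rmorphXn.
have const0 x : fps_const x j.+2 = 0 :> k by [].
rewrite DG !fps_addE !fps_XnME !const0 !add0r.
case: eqP => [Dj|].
  have -> : (j.+2 < m.+1)%N = false by lia.
  have -> : (j.+2 - m.+1 = 0)%N by lia.
  rewrite fps_addE fps_constME fps_XME addr0 -![_ 0%N]/(fps_ct _) ctT.
  have Dm : m = j.+1 by lia.
  have cj : c^-1 ^+ j * c ^+ j = 1 by rewrite -exprMn mulVf // expr1n.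
  rewrite Dm exprSr mulfK // mulNr mulrN opprK -mulrA [_ * (_ * fps_ct E)]mulrA cj mul1r.
  by rewrite -[j.+2%:R]natr1 mulrDl mul1r addrC.
move=> ne_j; have -> : (j.+2 < m.+1)%N by lia.
by rewrite subr0.
Qed.

(** Induction on [n], where the order of [b] is at least $3 - n$: a multiple of $1/(xy)$, $1/x$ or
    $y^j$ with $j \le m - 2$ removes the lowest term without changing [Delta]. *)
Let Delta_order n b a : (n <= m.+1)%N -> b * lvar ^+ n = lvar ^+ 3 * lser k a -> Delta b = 0.
Proof.
elim: n b a => [|n IHn] b a le_nm Db.
  by move: Db; rewrite mulr1 => ->.
have [w1 ww1] : exists w1, w * w1 = 1 by apply: fps_unit; rewrite ctw.
have w1_0 : fps_ct w1 != 0.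
  by apply: contra_eq_neq (congr1 fps_ct ww1) => t0; rewrite fps_ctM t0 mulr0 eq_sym oner_neq0.
have Dxi1 : xi^-1 = lvar * lser k w1.
  by rewrite invf_div; congr (_ * _); apply: (mulfI lw_neq0); rewrite divff // -rmorphM ww1 rmorph1.
have [B [u [DB u0 Delta_B]]] : exists B u,
    [/\ B * lvar ^+ n.+1 = lvar ^+ 3 * lser k u, fps_ct u != 0 & Delta B = 0].
  case: n {IHn Db} le_nm => [|[|n]] le_nm.
  - exists (lvar / xi), w1; split=> //.
    rewrite Dxi1 expr1 -mulrA [_ * lvar]mulrC mulrA -expr2.
    by rewrite [lvar ^+ 3]exprSr mulrA.
  - exists xi^-1, w1; split=> //.
    by rewrite Dxi1 mulrC mulrA -exprSr.
  - exists (lvar^-1 ^+ n), 1; split; last 1 first.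
    + by rewrite Delta_lvarV; [case: eqP => //; lia | lia].
    + by rewrite -[n.+3]addn3 exprD mulrA -exprMn mulVf ?lvar_neq0 // expr1n mul1r rmorph1 mulr1.
    + by rewrite [fps_ct 1]rmorph1 oner_neq0.
have b'0 : (a - fps_const (fps_ct a / fps_ct u) * u) 0%N = 0.
  by rewrite -/(fps_ct _) fps_ctB fps_ctM fps_ct_const mulfVK // subrr.
have -> : b = lconst k (fps_ct a / fps_ct u) * B + (b - lconst k (fps_ct a / fps_ct u) * B).
  by rewrite addrC subrK.
rewrite DeltaD DeltaZ Delta_B mulr0 add0r.
apply: (IHn _ (fps_behead (a - fps_const (fps_ct a / fps_ct u) * u))); first exact: ltnW.
apply: (mulIf (lvar_neq0 k)); rewrite -mulrA -exprSr mulrBl -mulrA DB Db.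
rewrite -[RHS]mulrA [lser k _ * lvar]mulrC -[lvar in RHS]/(lser k fps_X).
rewrite -(rmorphM (lser k) fps_X) -fps_beheadK // (rmorphB (lser k)) (rmorphM (lser k)).
by rewrite mulrBr [in RHS]mulrCA.
Qed.

(** Only the term of [b] in $y^{m-1}$ contributes; the rest has a pole of order at most $m - 2$. *)
Lemma local_residue b a : b * lvar ^+ m.-1 = lser k a ->
  res (b * xi) - res (psi (b / lvar)) = m.+1%:R * fps_ct E * fps_ct a.
Proof.
move=> Db; rewrite -/(Delta b).
have -> : b = lconst k (fps_ct a) * lvar^-1 ^+ m.-1 + (b - lconst k (fps_ct a) * lvar^-1 ^+ m.-1).
  by rewrite addrC subrK.
rewrite DeltaD DeltaZ Delta_lvarV ?eqxx; last by lia.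
rewrite (@Delta_order m.+1 _ (fps_behead a)) //; first by rewrite addr0 mulrC.
have -> : lvar ^+ m.+1 = lvar ^+ m.-1 * lvar ^+ 2 :> laurent k.
  by rewrite -exprD; congr (_ ^+ _); lia.
rewrite mulrA mulrBl Db -mulrA -exprMn mulVf ?lvar_neq0 // expr1n mulr1.
rewrite {1}(fps_split a) rmorphD rmorphM -/lvar addrAC subrr add0r.
by ring.
Qed.

End LocalResidue.

(** * Function field and branches at infinity *)

Section ImageField.
Variables (A : nzRingType) (F : fieldType) (e : {rmorphism A -> F}).

(** A concrete model, inside [F], of the field of fractions of the image of [e]. With [e] the
    evaluation at a branch it serves as the function field of the component. *)
Definition image_frac : {pred F} :=
  fun u => `[< exists g h, e h != 0 /\ u = e g / e h >].

Lemma image_fracP u : reflect (exists g h, e h != 0 /\ u = e g / e h) (u \in image_frac).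
Proof. exact: asboolP. Qed.

Lemma image_frac_divring : divring_closed image_frac.
Proof.
split=> [|_ _ /image_fracP[g [h [h0 ->]]] /image_fracP[g' [h' [h'0 ->]]]
         |_ _ /image_fracP[g [h [h0 ->]]] /image_fracP[g' [h' [h'0 ->]]]].
- by apply/image_fracP; exists 1, 1; rewrite rmorph1 divr1 oner_eq0.
- apply/image_fracP; exists (g * h' - g' * h), (h * h'); rewrite rmorphM mulf_neq0 //.
  by split=> //; rewrite -[- (e g' / _)]mulNr addf_div // rmorphB !rmorphM mulNr.
apply/image_fracP; have [g'0|g'0] := eqVneq (e g') 0.
  by exists 0, 1; rewrite g'0 mul0r invr0 mulr0 rmorph0 mul0r rmorph1 oner_eq0.
exists (g * h'), (h * g'); rewrite rmorphM mulf_neq0 //; split=> //.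
by rewrite invf_div mulf_div rmorphM.
Qed.

HB.instance Definition _ := GRing.isDivringClosed.Build F image_frac image_frac_divring.

Record image_field := ImageField { image_val :> F; _ : image_val \in image_frac }.

HB.instance Definition _ := [isSub for image_val].
HB.instance Definition _ := [Choice of image_field by <:].
HB.instance Definition _ := [SubChoice_isSubIntegralDomain of image_field by <:].
HB.instance Definition _ := [SubIntegralDomain_isSubField of image_field by <:].

Lemma image_mem a : e a \in image_frac.
Proof. by apply/image_fracP; exists a, 1; rewrite rmorph1 divr1 oner_eq0. Qed.

Definition to_image a : image_field := ImageField (image_mem a).

Lemma to_image_zmod : zmod_morphism to_image.
Proof. by move=> a b; apply: val_inj; rewrite rmorphB /= rmorphB. Qed.
Lemma to_image_monoid : monoid_morphism to_image.
Proof.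
by split=> [|a b]; apply: val_inj; rewrite ?rmorph1 ?rmorphM /= ?rmorph1 ?rmorphM.
Qed.
HB.instance Definition _ := GRing.isZmodMorphism.Build A image_field to_image to_image_zmod.
HB.instance Definition _ := GRing.isMonoidMorphism.Build A image_field to_image to_image_monoid.

Lemma to_image_eq0 a : to_image a = 0 <-> e a = 0.
Proof.
split=> [/(congr1 val)|ea0]; first by rewrite rmorph0.
by apply: val_inj; rewrite rmorph0.
Qed.

Lemma image_fieldP (u : image_field) : exists g h, to_image h != 0 /\ u = to_image g / to_image h.
Proof.
have /image_fracP[g [h [h0 Du]]] := valP u; exists g, h.
have h0' : to_image h != 0 by apply: contra_neq h0 => /to_image_eq0.
by split=> //; apply: val_inj; rewrite fmorph_div.
Qed.

End ImageField.

(** * Branches at infinity from Hensel's lemma *)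

Section Branches.
Variables (k : fieldType) (P Q : {poly k}) (n : nat).
Hypotheses (szP : size P = n.+1) (szQ : size Q = n.+1) (n0 : (n%:R : k) != 0).
Hypothesis gapP : forall i, (n < i + 4)%N -> (i < n)%N -> P`_i = 0.
Hypothesis gapQ : forall i, (n < i + 4)%N -> (i < n)%N -> Q`_i = 0.

(** This is $s^nP(w/s)$ as a polynomial in $w$, where $w = sx$. *)
Definition dehomog (P : {poly k}) n : {poly fps k} := \poly_(i < n.+1) (fps_const P`_i * fps_X ^+ (n - i)).

Lemma dehomog_horner (p : {poly k}) (w : fps k) : (size p <= n.+1)%N ->
  lser k (dehomog p n).[w] = (map_poly (lconst k) p).[lser k w / lvar] * lvar ^+ n.
Proof.
move=> szp; have szm : (size (map_poly (lconst k) p) <= n.+1)%N.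
  exact: leq_trans (size_poly _ _) szp.
rewrite (horner_coef_wide _ szm) (horner_coef_wide _ (size_poly _ _)) rmorph_sum mulr_suml.
apply: eq_bigr => i _; rewrite coef_poly ltn_ord coef_map !rmorphM !rmorphXn -/lvar -!mulrA.
congr (_ * _); rewrite exprMn -mulrA mulrC; congr (_ * _).
have -> : lvar ^+ n = lvar ^+ (i + (n - i)) :> laurent k.
  by congr (_ ^+ _); have := ltn_ord i; lia.
by rewrite exprD mulrA -exprMn mulVf ?lvar_neq0 // expr1n mul1r.
Qed.

(** Hensel's lemma for $W = s^nP(w/s) - s^nQ(1/s)$: at $s = 0$ it reduces to $a_nw^n - b_n$, of
    which [c] is a simple root. *)
Lemma branch c : c != 0 -> lead_coef P * c ^+ n = lead_coef Q -> exists w,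
  [/\ fps_ct w = c, exists E, w = fps_const c + fps_X ^+ 4 * E &
      (map_poly (lconst k) P).[lser k w / lvar] = (map_poly (lconst k) Q).[lvar^-1]].
Proof.
move=> c0 Dc; pose W := dehomog P n - (dehomog Q n).[1]%:P.
have gt_n0 : (0 < n)%N by apply: contraNT n0; rewrite lt0n negbK => /eqP ->.
have ctD p i : (dehomog p n)`_i 0%N = if i == n then p`_n else 0.
  rewrite coef_poly; case: ltnP => [le_in|]; last by case: eqP => // ->; rewrite ltnn.
  rewrite fps_constME; case: eqP => [->|ne_in]; first by rewrite subnn mulr1.
  have -> : (n - i = (n - i).-1.+1)%N by lia.
  by rewrite exprS fps_XME mulr0.
have mapD p : map_poly fps_ct (dehomog p n) = p`_n *: 'X^n.
  apply/polyP => i; rewrite coef_map coefZ coefXn [LHS]ctD.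
  by case: eqP => _; rewrite ?mulr1 ?mulr0.
(* By the gap below the leading term, terms other than the leading one enter only from $s^4$ on. *)
have gapD (p : {poly k}) x j : (forall i, (n < i + 4)%N -> (i < n)%N -> p`_i = 0) -> (j < 4)%N ->
    (dehomog p n).[fps_const x] j = fps_const (p`_n * x ^+ n) j.
  move=> gap lt_j4.
  have -> : (dehomog p n).[fps_const x] =
      \sum_(i < n.+1) fps_X ^+ (n - i) * fps_const (p`_i * x ^+ i).
    rewrite (horner_coef_wide _ (size_poly _ _)); apply: eq_bigr => i _.
    by rewrite coef_poly ltn_ord mulrAC mulrC rmorphM (rmorphXn (@fps_const k)).
  rewrite fps_sumE (bigD1 ord_max) // fps_XnME subnn subn0 big1.
    exact: addr0.
  move=> i ne_i.
  have lt_in : (i < n)%N by rewrite ltn_neqAle -ltnS ltn_ord andbT; exact: ne_i.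
  rewrite fps_XnME; case: ltnP => // le_j.
  by rewrite gap ?mul0r ?rmorph0 ?fps_zeroE //; lia.
have leadP : lead_coef P = P`_n by rewrite lead_coefE szP.
have leadQ : lead_coef Q = Q`_n by rewrite lead_coefE szQ.
have mapW : map_poly fps_ct W = P`_n *: 'X^n - (Q`_n)%:P.
  rewrite rmorphB /= mapD map_polyC /=; congr (_ - _%:P).
  by rewrite -horner_map mapD rmorph1 hornerZ hornerXn expr1n mulr1.
have W'c : (map_poly fps_ct W)^`().[c] = P`_n * (n%:R * c ^+ n.-1).
  rewrite mapW derivB derivC subr0 derivZ derivXn hornerZ hornerMn hornerXn.
  by rewrite mulr_natl.
have a0 : P`_n != 0 by rewrite -leadP lead_coef_eq0 -size_poly_eq0 szP.
have W'c0 : (map_poly fps_ct W)^`().[c] != 0 by rewrite W'c !mulf_neq0 ?expf_neq0.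
have [|w [ctw Ww]] := hensel _ W'c0.
  by rewrite mapW hornerD hornerN hornerZ hornerXn hornerC -leadP Dc leadQ subrr.
exists w; split=> //.
  (* By Taylor's formula $-W(c)$ is $w - c$ times a unit, and $W(c)$ is divisible by $s^4$. *)
  pose h := w - fps_const c.
  have [q Dq] := horner_taylor2 W (fps_const c) h.
  have [G DG] : exists G, W.[fps_const c] = fps_X ^+ 4 * G.
    exists (Fps (fun j => W.[fps_const c] (j + 4)%N)); apply: fps_dropK => j lt_j4.
    rewrite /W hornerD hornerN hornerC fps_subE (gapD P) // -(rmorph1 (@fps_const k)) (gapD Q) //.
    by rewrite expr1n mulr1 -leadP -leadQ Dc subrr.
  have [v hv] : exists v, (W^`().[fps_const c] + h * q) * v = 1.
    apply: fps_unit; rewrite fps_ctD [fps_ct (h * q)]fps_ctM [fps_ct h]fps_ctB ctw subrr mul0r addr0.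
    by rewrite -horner_map /= -deriv_map.
  exists (- G * v); rewrite -[LHS](subrK (fps_const c)) addrC -/h; congr (_ + _).
  have Dh : W^`().[fps_const c] * h + h ^+ 2 * q = - (fps_X ^+ 4 * G).
    apply/eqP; rewrite -addr_eq0 addrC addrA -DG -Dq /h addrC subrK Ww //.
  rewrite -[LHS]mulr1 -hv.
  transitivity ((W^`().[fps_const c] * h + h ^+ 2 * q) * v); first by ring.
  by rewrite Dh; ring.
have := dehomog_horner w (eq_leq szP); have := dehomog_horner 1 (eq_leq szQ).
rewrite rmorph1 div1r => DQ DP.
apply: (mulIf (_ : lvar ^+ n != 0)); first by rewrite expf_neq0 ?lvar_neq0.
rewrite -DP -DQ; congr (lser k _).
by apply/eqP; rewrite -subr_eq0; move/eqP: Ww; rewrite /W !hornerE.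
Qed.

End Branches.

(** Expansion in powers of the uniformizer $t = s/w = 1/x$; it is injective on series, so it extends
    to Laurent series. *)
Lemma reexpansion (k : fieldType) (c : k) (w : fps k) : c != 0 -> fps_ct w = c ->
  exists psi : {rmorphism laurent k -> laurent k},
    [/\ forall x, psi (lconst k x) = lconst k x, psi (lser k w / lvar) = lvar^-1
      & forall a, exists a', psi (lser k a) = lser k a' /\ fps_ct a' = fps_ct a].
Proof.
move=> c0 ctw; have [v wv] : exists v, w * v = 1 by apply: fps_unit; rewrite ctw.
pose t := fps_X * v.
have t0 : fps_ct t = 0 by rewrite fps_ctM fps_ctX mul0r.
have tw : t * w = fps_X by rewrite /t -mulrA [v * w]mulrC wv mulr1.
pose r := expand_rmorphism t0 tw.
have [||psi psiE] := @extend_to_fractions _ _ _ (lser k) (lser k \o r).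
- move=> u; have [a [b [b0 ->]]] := laurent_frac u; exists a, b; split=> //.
  by rewrite tofrac_eq0.
- move=> a; split=> /eqP; rewrite /= tofrac_eq0 => /eqP.
    by move=> ->; exact: (rmorph0 (lser k \o r)).
  by move=> /(expand_inj t0 tw) ->; exact: (rmorph0 (lser k)).
exists psi; split.
- by move=> x; rewrite [LHS]psiE /= [r _](expand_const t0 tw).
- have w0 : lser k w != 0.
    by apply: contra_eq_neq (congr1 (lser k) wv) => w0; rewrite rmorphM w0 mul0r rmorph1 eq_sym oner_neq0.
  have -> : lser k w / lvar = (lser k t)^-1.
    rewrite /lvar -tw rmorphM invfM mulrCA divff // mulr1 //.
  by rewrite fmorphV psiE /= [r _](expand_unif t0 tw).
by move=> a; exists (r a); rewrite psiE.
Qed.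

Lemma poly_rmorph_ext (R S : comNzRingType) (e1 e2 : {rmorphism {poly R} -> S}) :
  (forall c, e1 c%:P = e2 c%:P) -> e1 'X = e2 'X -> e1 =1 e2.
Proof.
move=> eqC eqX p; rewrite (rmorph_poly_horner e1) (rmorph_poly_horner e2) eqX; congr (_.[_]).
exact: eq_map_poly.
Qed.

Lemma bipoly_rmorph_ext (S : comNzRingType) (e1 e2 : {rmorphism bipoly -> S}) :
  (forall c, e1 (cst c) = e2 (cst c)) -> e1 varx = e2 varx -> e1 vary = e2 vary ->
  e1 =1 e2.
Proof.
move=> eqC eqx eqy; apply: poly_rmorph_ext => // p.
exact: (poly_rmorph_ext (e1 := e1 \o polyC) (e2 := e2 \o polyC)).
Qed.

Lemma lead_coef_factor (f g : bipoly) (l : CC) : l != 0 -> lead_coef (f * g) = l%:P ->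
  exists2 l', l' != 0 & lead_coef f = l'%:P.
Proof.
rewrite lead_coefM => l0 Dl.
have : lead_coef f * lead_coef g != 0 by rewrite Dl polyC_eq0.
rewrite mulf_eq0 negb_or => /andP[f0 g0].
have /size_poly1P[c c0 ->] : size (lead_coef f) == 1%N; last by exists c.
have := congr1 (size \o polyseq) Dl; rewrite /= size_mul // size_polyC l0.
by move: f0 g0; rewrite -!size_poly_gt0; move: (size _) (size _) => a b; lia.
Qed.

Lemma unit_roots (n : nat) (z : CC) : (0 < n)%N -> z != 0 ->
  exists cs : seq CC, [/\ uniq cs, size cs = n & forall c, c \in cs -> c ^+ n = z].
Proof.
move=> n0 z0; have [cs Dcs] := closed_field_poly_normal ('X^n - z%:P : {poly CC}).
have lead1 : lead_coef ('X^n - z%:P : {poly CC}) = 1 by rewrite lead_coefDl ?lead_coefXn // size_polyN size_polyXn size_polyC z0.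
rewrite lead1 scale1r in Dcs.
exists cs; split.
- rewrite -separable_prod_XsubC -Dcs unlock; apply/Pdiv.ClosedField.coprimepP => x.
  rewrite derivB derivC subr0 derivXn hornerMn hornerXn mulrn_eq0 negb_or -lt0n n0 /=.
  rewrite /root !hornerE => /eqP/subr0_eq Dz; apply: expf_neq0.
  by apply: contra_neq z0 => x0; rewrite -Dz x0 expr0n gtn_eqF.
- have := size_prod_XsubC cs id; rewrite -Dcs size_XnsubC // => -[].
  by [].
move=> c c_cs; have : root ('X^n - z%:P) c by rewrite Dcs root_prod_XsubC.
by rewrite /root !hornerE => /eqP/subr0_eq.
Qed.

Lemma laurent_lser_or_inv (k : fieldType) (u : laurent k) :
  (exists a, u = lser k a) \/ (exists a, u^-1 = lser k a).
Proof.
have unitV a : fps_ct a != 0 -> exists b, (lser k a)^-1 = lser k b.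
  move=> /fps_unit[b ab]; exists b.
  have a0 : lser k a != 0.
    by apply: contra_eq_neq (congr1 (lser k) ab) => w0; rewrite rmorphM w0 mul0r rmorph1 eq_sym oner_neq0.
  by apply: (mulfI a0); rewrite divff // -rmorphM ab rmorph1.
have key m n a b : (m <= n)%N -> fps_ct b != 0 ->
    exists d, lser k (fps_X ^+ n * a) / lser k (fps_X ^+ m * b) = lser k d.
  move=> le_mn /unitV[d Dd]; exists (fps_X ^+ (n - m) * a * d).
  rewrite !rmorphM invfM Dd !rmorphXn -/lvar mulrACA -[RHS]mulrA; congr (_ * _).
  have lm0 : (lvar : laurent k) ^+ m != 0 by rewrite expf_neq0 ?lvar_neq0.
  by apply: (mulIf lm0); rewrite mulfVK // -exprD subnK.
have [a [b [b0 ->]]] := laurent_frac u.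
have [->|a0] := eqVneq a 0; first by left; exists 0; rewrite !rmorph0 mul0r.
have [m [d [-> d0]]] := fps_valuation a0; have [n [h [-> h0]]] := fps_valuation b0.
case: (leqP n m) => [le_nm|/ltnW le_mn]; [left|right; rewrite invf_div]; exact: key.
Qed.

Lemma lser_div_lvar (k : fieldType) (a b : fps k) : lser k a / lvar = lser k b -> fps_ct a = 0.
Proof.
move=> Dab; have /lser_inj -> : lser k a = lser k (b * fps_X).
  by rewrite rmorphM -Dab mulfVK ?lvar_neq0.
by rewrite fps_ctM fps_ctX mulr0.
Qed.

Definition regular_at (K : fieldType) (sigma : {rmorphism K -> laurent CC}) : K -> Prop :=
  fun u => exists a, sigma u = lser CC a.

(** The $s$-adic valuation ring pulled back to [K]; it is proper because [y] goes to $1/s$. *)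
Lemma regular_at_place (K : fieldType) (iota : {rmorphism CC -> K})
    (sigma : {rmorphism K -> laurent CC}) y :
    (forall c, sigma (iota c) = lconst CC c) -> sigma y = lvar^-1 ->
  is_place iota (regular_at sigma).
Proof.
move=> sigmaC sigma_y; split.
- by split; [exists 0 | exists 1]; rewrite ?rmorph0 ?rmorph1.
- by move=> a b [a' Da] [b' Db]; exists (a' - b'); rewrite !rmorphB Da Db.
- by move=> a b [a' Da] [b' Db]; exists (a' * b'); rewrite !rmorphM Da Db.
- by move=> c; exists (fps_const c); rewrite sigmaC.
split=> [a _|]; first by rewrite /regular_at fmorphV; exact: laurent_lser_or_inv.
exists y => -[a]; rewrite sigma_y -[lvar^-1]mul1r -(rmorph1 (lser CC)) => /lser_div_lvar/eqP.
by rewrite [fps_ct 1]rmorph1 oner_eq0.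
Qed.

(** As $x - cy$ has degree 1 in $y$ and [f] has positive degree, the cofactor is free of $y$;
    leading coefficients show that it is a constant. *)
Lemma linear_of_dvd (f : bipoly) (l c : CC) : l != 0 -> lead_coef f = l%:P ->
  (1 < size f)%N -> c != 0 -> bdvd f (varx - cst c * vary) -> deg_one f.
Proof.
move=> l0 lead_f f1 c0 [h Dh].
have Dlin : varx - cst c * vary = - c%:P%:P * 'X + 'X%:P.
  by rewrite /varx /cst /vary addrC mulNr.
have nc0 : - c%:P != 0 :> {poly CC} by rewrite oppr_eq0 polyC_eq0.
have szl : size (varx - cst c * vary) = 2%N.
  by rewrite Dlin -polyCN size_MXaddC polyC_eq0 (negPf nc0) size_polyC nc0.
have f0 : f != 0 by rewrite -size_poly_gt0 ltnW.
have h0 : h != 0 by apply: contra_eq_neq szl => h0; rewrite Dh h0 mulr0 size_poly0.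
have /size_poly1P[d d0 Dd] : size h == 1%N.
  have szfh : (size f + size h).-1 = 2%N by rewrite -size_mul // -Dh.
  have arith (a b : nat) : ((a + b).-1 = 2 -> 1 < a -> 0 < b -> b = 1)%N by lia.
  by apply/eqP; apply: (arith _ _ szfh f1); rewrite size_poly_gt0.
have Dc : - c%:P = l%:P * d.
  have := congr1 lead_coef Dh; rewrite lead_coefM lead_f Dd lead_coefC => <-.
  by rewrite /lead_coef szl Dlin coefD mulNr coefN coefMX !coefC /= addr0.
have Dd' : d = (- c / l)%:P.
  apply: (mulfI (_ : l%:P != 0)); first by rewrite polyC_eq0.
  by rewrite -Dc -polyCM mulrCA divff // mulr1 polyCN.
(* The cofactor is $-c/l$, so $f = -(l/c)(x - cy)$. *)
exists 0, (- l / c), l; split; first by right.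
have Df : f * (cst (- c / l)) = varx - cst c * vary by rewrite Dh Dd Dd'.
have cl0 : cst (- c / l) != 0 by rewrite !polyC_eq0 mulf_neq0 ?oppr_eq0 ?invr_eq0.
apply: (mulIf cl0); rewrite Df /cst rmorph0 add0r mulrDl.
rewrite mulrAC -!rmorphM /= [_ * vary * _]mulrAC -!rmorphM /=.
have -> : - l / c * (- c / l) = 1 by field; rewrite l0 c0.
have -> : l * (- c / l) = - c by field.
by rewrite !rmorphN !rmorph1 mul1r mulNr.
Qed.

(** * Branches of the curve and of its components *)

Notation lcc := (lconst CC).
Notation evinf := (peval (lconst CC) lvar^-1).

Definition branch_x (w : fps CC) : laurent CC := lser CC w / lvar.
Definition ev_branch (w : fps CC) : {rmorphism bipoly -> laurent CC} :=
  peval (peval lcc (branch_x w)) lvar^-1.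

Lemma ev_branch_cst w c : ev_branch w (cst c) = lcc c.
Proof. by rewrite /ev_branch !pevalC. Qed.
Lemma ev_branch_x w : ev_branch w varx = branch_x w.
Proof. by rewrite /ev_branch pevalC pevalX. Qed.
Lemma ev_branch_y w : ev_branch w vary = lvar^-1.
Proof. by rewrite /ev_branch pevalX. Qed.

(** With $y = 1/s$ fixed, [branch_x w] is a root in $x$ of every [h] that vanishes on the branch. *)
Lemma ev_branch_swap w h : (map_poly evinf (swapXY h)).[branch_x w] = ev_branch w h.
Proof.
rewrite -pevalE; apply: (bipoly_rmorph_ext (e1 := peval evinf (branch_x w) \o swapXY)).
- by move=> c; rewrite ev_branch_cst /= swapXY_polyC map_polyC /= !pevalC.
- by rewrite ev_branch_x /= swapXY_Y pevalX.
- by rewrite ev_branch_y /= swapXY_X !pevalC pevalX.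
Qed.

(** The same branch with $x = 1/s$ as base: its $y$-coordinate is [psi lvar^-1]. *)
Lemma ev_branch_reexpand w (psi : {rmorphism laurent CC -> laurent CC}) h :
    (forall x, psi (lcc x) = lcc x) -> psi (branch_x w) = lvar^-1 ->
  (map_poly evinf h).[psi lvar^-1] = psi (ev_branch w h).
Proof.
move=> psiC psix; rewrite -pevalE.
apply: (bipoly_rmorph_ext (e1 := peval evinf (psi lvar^-1)) (e2 := psi \o ev_branch w)).
- by move=> c; rewrite [RHS]/= ev_branch_cst psiC !pevalC.
- by rewrite [RHS]/= ev_branch_x psix pevalC pevalX.
- by rewrite [RHS]/= ev_branch_y pevalX.
Qed.

(** A branch at infinity: $x = w/s$ with $w = c + s^4E$, together with the reexpansion [br_psi] in
    powers of $1/x$. *)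
Record branch_data := BranchData {
  br_c : CC; br_w : fps CC; br_E : fps CC;
  br_psi : {rmorphism laurent CC -> laurent CC} }.

Definition branch_ok (B : branch_data) : Prop :=
  [/\ br_c B != 0, br_w B = fps_const (br_c B) + fps_X ^+ 4 * br_E B,
      forall x, br_psi B (lcc x) = lcc x,
      br_psi B (branch_x (br_w B)) = lvar^-1
    & forall a, exists a', br_psi B (lser CC a) = lser CC a' /\ fps_ct a' = fps_ct a].

Lemma branch_ok_ct B : branch_ok B -> fps_ct (br_w B) = br_c B.
Proof.
by case=> _ -> _ _ _; rewrite fps_ctD fps_ctM exprS fps_ctM fps_ctX !mul0r addr0.
Qed.

(** On the branch $1/y = c/x + \dots$, so the expansion in $1/x$ determines [c]. *)
Lemma br_psi_lvarV_inj B B' : branch_ok B -> branch_ok B' ->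
  br_psi B lvar^-1 = br_psi B' lvar^-1 -> br_c B = br_c B'.
Proof.
have psiV D : branch_ok D -> exists w',
    (br_psi D lvar^-1)^-1 = lvar * lser CC w' /\ fps_ct w' = br_c D.
  move=> Dok; have [c0 _ _ psix psi_lser] := Dok.
  have [w' [Dw' ctw']] := psi_lser (br_w D); exists w'.
  rewrite ctw' branch_ok_ct //; split=> //.
  have w0 : lser CC (br_w D) != 0.
    apply: contra_neq c0 => w0; rewrite -branch_ok_ct //.
    by rewrite (_ : br_w D = 0) ?rmorph0 //; apply: (@lser_inj CC); rewrite w0 rmorph0.
  rewrite -fmorphV invrK.
  have lx : lvar = lser CC (br_w D) / branch_x (br_w D).
    by rewrite /branch_x invf_div mulrCA divff ?mulr1.
  by rewrite {1}lx rmorphM fmorphV psix invrK Dw' mulrC.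
move=> /psiV[w1 [D1 <-]] /psiV[w2 [D2 <-]] eqV; congr fps_ct.
by apply: (@lser_inj CC); apply: (mulfI (lvar_neq0 CC)); rewrite -D1 -D2 eqV.
Qed.

Lemma branch_x_inj B B' : branch_ok B -> branch_ok B' ->
  branch_x (br_w B) = branch_x (br_w B') -> br_c B = br_c B'.
Proof.
move=> Bok B'ok; have lV0 : (lvar^-1 : laurent CC) != 0 by rewrite invr_eq0 lvar_neq0.
by move=> /(mulIf lV0)/(@lser_inj CC) eqw; rewrite -!branch_ok_ct // eqw.
Qed.

Section Factor.
Variables (P Q : {poly CC}) (n : nat) (f g : bipoly).
Hypotheses (n0 : (0 < n)%N) (szP : size P = n.+1) (szQ : size Q = n.+1).
Hypothesis gapP : forall i, (n < i + 4)%N -> (i < n)%N -> P`_i = 0.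
Hypothesis gapQ : forall i, (n < i + 4)%N -> (i < n)%N -> Q`_i = 0.
Hypotheses (irr_f : birreducible f) (Dfg : PxQy P Q = f * g).

Let leadP0 : lead_coef P != 0. Proof. by rewrite lead_coef_eq0 -size_poly_eq0 szP. Qed.
Let leadQ0 : lead_coef Q != 0. Proof. by rewrite lead_coef_eq0 -size_poly_eq0 szQ. Qed.

Lemma lead_PxQy : lead_coef (PxQy P Q) = (- lead_coef Q)%:P.
Proof.
rewrite /PxQy addrC lead_coefDl ?lead_coefN ?lead_coef_map_inj ?rmorph0 ?polyCN //.
  exact: polyC_inj.
rewrite size_polyN size_map_polyC szQ (leq_ltn_trans (size_polyC_leq1 _)) //.
Qed.

Lemma swapXY_PxQy : swapXY (PxQy P Q) = map_poly polyC P - Q%:P.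
Proof. by rewrite /PxQy rmorphB /= swapXY_polyC swapXY_map_polyC. Qed.

Lemma lead_swap_PxQy : lead_coef (swapXY (PxQy P Q)) = (lead_coef P)%:P.
Proof.
rewrite swapXY_PxQy lead_coefDl ?lead_coef_map_inj ?rmorph0 //.
  exact: polyC_inj.
rewrite size_polyN size_map_polyC szP (leq_ltn_trans (size_polyC_leq1 _)) //.
Qed.

Lemma size_PxQy : size (PxQy P Q) = n.+1.
Proof.
rewrite /PxQy addrC size_polyDl size_polyN size_map_polyC szQ //.
by rewrite (leq_ltn_trans (size_polyC_leq1 _)).
Qed.

Lemma size_swap_PxQy : size (swapXY (PxQy P Q)) = n.+1.
Proof.
rewrite swapXY_PxQy size_polyDl size_map_polyC szP // size_polyN.
by rewrite (leq_ltn_trans (size_polyC_leq1 _)).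
Qed.

Lemma lead_factor : exists2 l, l != 0 & lead_coef f = l%:P.
Proof.
have lQ0 : - lead_coef Q != 0 by rewrite oppr_eq0.
by apply: (lead_coef_factor lQ0 (g := g)); rewrite -Dfg lead_PxQy.
Qed.

Lemma lead_swap_factor : exists2 l, l != 0 & lead_coef (swapXY f) = l%:P.
Proof.
apply: (lead_coef_factor leadP0 (g := swapXY g)).
by rewrite -rmorphM /= -Dfg lead_swap_PxQy.
Qed.

Lemma size_factor : (1 < size f)%N.
Proof.
have [f0 [nu_f _]] := irr_f; have [l l0 lead_f] := lead_factor.
rewrite ltnNge; apply: contra nu_f => sz1.
have -> : f = l%:P%:P by rewrite (size1_polyC sz1) -lead_f {2}(size1_polyC sz1) lead_coefC.
by rewrite !poly_unitE size_polyC polyC_eq0 l0 coefC eqxx size_polyC l0 coefC eqxx unitfE.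
Qed.

Lemma size_swap_factor : (1 < size (swapXY f))%N.
Proof.
have [f0 [nu_f _]] := irr_f; have [l l0 lead_f] := lead_swap_factor.
rewrite ltnNge; apply: contra nu_f => sz1.
have -> : f = l%:P%:P.
  rewrite -[f](@swapXYK CC) [swapXY f](_ : _ = l%:P%:P) ?swapXY_polyC ?map_polyC //.
  by rewrite (size1_polyC sz1) -lead_f {2}(size1_polyC sz1) lead_coefC.
by rewrite !poly_unitE size_polyC polyC_eq0 l0 coefC eqxx size_polyC l0 coefC eqxx unitfE.
Qed.

Lemma evinf_inj : injective evinf.
Proof.
move=> p q eq_pq; apply/eqP; rewrite -subr_eq0; apply/eqP.
by apply: (peval_inj (@lvarV_nconst CC)); rewrite rmorphB eq_pq subrr.
Qed.

(** The $n$-th roots of $b_n/a_n$ are the directions of the curve at infinity, and each carries one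
    branch. *)
Lemma all_branches : exists2 Bs : seq branch_data,
  [/\ uniq (map br_c Bs), size Bs = n & forall i, (i < size Bs)%N -> 
     branch_ok (nth (BranchData 0 0 0 idfun) Bs i)] &
  forall i, (i < size Bs)%N -> ev_branch (br_w (nth (BranchData 0 0 0 idfun) Bs i)) (PxQy P Q) = 0.
Proof.
have z0 : lead_coef Q / lead_coef P != 0 by rewrite mulf_neq0 ?invr_eq0.
have [cs [uniq_cs sz_cs csP]] := unit_roots n0 z0.
have char0 : n%:R != 0 :> CC by rewrite pnatr_eq0 -lt0n.
(* Outside [cs] an arbitrary value serves as a default. *)
have /choice[B BP] : forall c, exists B, c \in cs ->
    [/\ br_c B = c, branch_ok B & ev_branch (br_w B) (PxQy P Q) = 0].
  move=> c; have [c_cs|] := boolP (c \in cs); last by exists (BranchData 0 0 0 idfun).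
  have c0 : c != 0.
    by apply: contra_eq_neq (csP c c_cs) => ->; rewrite expr0n gtn_eqF // eq_sym.
  have Dc : lead_coef P * c ^+ n = lead_coef Q by rewrite csP // mulrC divfK.
  have [w [ctw [E DE] DPQ]] := branch szP szQ char0 gapP gapQ c0 Dc.
  have [psi [psiC psix psiL]] := reexpansion c0 ctw.
  exists (BranchData c w E psi) => _; split=> //.
  rewrite /PxQy rmorphB; apply/eqP; rewrite subr_eq0; apply/eqP.
  rewrite {1}/ev_branch pevalC pevalE DPQ.
  rewrite /ev_branch pevalE -map_poly_comp; congr (_.[_]).
  by apply: eq_map_poly => x; rewrite [RHS]pevalC.
exists (map B cs).
  split; last by rewrite size_map => i lt_i; rewrite (nth_map 0) //; case: (BP cs`_i); rewrite ?mem_nth.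
    rewrite -map_comp map_id_in // => c c_cs; by case: (BP c c_cs).
  by rewrite size_map.
by rewrite size_map => i lt_i; rewrite (nth_map 0) //; case: (BP cs`_i); rewrite ?mem_nth.
Qed.

(** The $n$ branches account for all roots of $P(x) - Q(y)$, both in $x$ over series in $1/y$ and in
    $y$ over series in $1/x$; the roots of [f] are those of the branches on which it vanishes. *)
Lemma factor_branches : exists (r : nat) (B : 'I_r -> branch_data), [/\ (0 < r)%N,
   forall i, branch_ok (B i) /\ ev_branch (br_w (B i)) f = 0,
   forall i j, br_c (B i) = br_c (B j) -> i = j,
   exists l, [/\ l != 0, lead_coef (swapXY f) = l%:P &
     map_poly evinf (swapXY f) = lcc l *: \prod_i ('X - (branch_x (br_w (B i)))%:P)] &
   exists l, [/\ l != 0, lead_coef f = l%:P &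
     map_poly evinf f = lcc l *: \prod_i ('X - (br_psi (B i) lvar^-1)%:P)]].
Proof.
have [Bs [uniq_c sz_Bs okB] evB] := all_branches.
set B0 := BranchData _ _ _ _ in okB evB.
pose p := fun i : 'I_n => ev_branch (br_w (nth B0 Bs i)) f == 0.
pose S := [seq i <- enum 'I_n | p i].
have ok (i : 'I_n) : branch_ok (nth B0 Bs i) by apply: okB; rewrite sz_Bs.
have c_inj (i j : 'I_n) : br_c (nth B0 Bs i) = br_c (nth B0 Bs j) -> i = j.
  rewrite -!(nth_map B0 (br_c B0)) ?sz_Bs // => /eqP.
  by rewrite nth_uniq ?size_map ?sz_Bs // => /eqP/val_inj.
have S_uniq : uniq S by rewrite filter_uniq // enum_uniq.
pose B (i : 'I_(size S)) := nth B0 Bs (tnth (in_tuple S) i).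
have prodS (h : 'I_n -> {poly laurent CC}) :
    \prod_(i <- enum 'I_n | p i) h i = \prod_(i < size S) h (tnth (in_tuple S) i).
  by rewrite -big_filter -/S big_tnth.
have [l l0 lead_f] := lead_factor; have [l' l'0 lead_f'] := lead_swap_factor.
have fac1 : map_poly evinf (swapXY f) = lcc l' *: \prod_i ('X - (branch_x (br_w (B i)))%:P).
  have uniq_x : uniq [seq branch_x (br_w (nth B0 Bs (i : 'I_n))) | i <- enum 'I_n].
    by rewrite map_inj_uniq ?enum_uniq // => i j eqx; apply/c_inj/branch_x_inj.
  have Dpq : map_poly evinf (swapXY f) * map_poly evinf (swapXY g) =
      lcc (lead_coef P) *: \prod_(r <- [seq branch_x (br_w (nth B0 Bs (i : 'I_n))) | i <- enum 'I_n]) ('X - r%:P).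
    have -> : map_poly evinf (swapXY f) * map_poly evinf (swapXY g) =
        map_poly evinf (swapXY (PxQy P Q)) by rewrite Dfg !rmorphM.
    have lead1 : lead_coef (map_poly evinf (swapXY (PxQy P Q))) = lcc (lead_coef P).
      by rewrite lead_coef_map_inj ?rmorph0 ?lead_swap_PxQy ?pevalC //; exact: evinf_inj.
    rewrite -lead1; apply: all_roots_prod_XsubC.
    - by rewrite size_map size_enum_ord size_map_inj_poly ?rmorph0 ?size_swap_PxQy //; exact: evinf_inj.
    - apply/allP => _ /mapP[i _ ->]; rewrite /root ev_branch_swap evB ?sz_Bs //.
    - by rewrite uniq_rootsE.
  have lP0 : lcc (lead_coef P) != 0 by rewrite fmorph_eq0.
  rewrite {1}(split_factor_roots lP0 uniq_x Dpq).
  rewrite (lead_coef_map_inj evinf_inj (rmorph0 _)) lead_f' pevalC.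
  congr (_ *: _); rewrite big_map -(prodS (fun i => 'X - (branch_x (br_w (nth B0 Bs i)))%:P)).
  by apply: eq_bigl => i; rewrite /root ev_branch_swap.
have fac2 : map_poly evinf f = lcc l *: \prod_i ('X - (br_psi (B i) lvar^-1)%:P).
  have uniq_y : uniq [seq br_psi (nth B0 Bs (i : 'I_n)) lvar^-1 | i <- enum 'I_n].
    by rewrite map_inj_uniq ?enum_uniq // => i j eqy; apply/c_inj/br_psi_lvarV_inj.
  have Dpq : map_poly evinf f * map_poly evinf g =
      lcc (- lead_coef Q) *: \prod_(r <- [seq br_psi (nth B0 Bs (i : 'I_n)) lvar^-1 | i <- enum 'I_n]) ('X - r%:P).
    have -> : map_poly evinf f * map_poly evinf g = map_poly evinf (PxQy P Q).
      by rewrite Dfg rmorphM.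
    have lead1 : lead_coef (map_poly evinf (PxQy P Q)) = lcc (- lead_coef Q).
      by rewrite lead_coef_map_inj ?rmorph0 ?lead_PxQy ?pevalC //; exact: evinf_inj.
    rewrite -lead1; apply: all_roots_prod_XsubC.
    - by rewrite size_map size_enum_ord size_map_inj_poly ?rmorph0 ?size_PxQy //; exact: evinf_inj.
    - apply/allP => _ /mapP[i _ ->]; have [_ _ psiC psix _] := ok i.
      by rewrite /root (ev_branch_reexpand _ psiC psix) evB ?sz_Bs ?rmorph0.
    - by rewrite uniq_rootsE.
  have lQ0 : lcc (- lead_coef Q) != 0 by rewrite fmorph_eq0 oppr_eq0.
  rewrite {1}(split_factor_roots lQ0 uniq_y Dpq).
  rewrite (lead_coef_map_inj evinf_inj (rmorph0 _)) lead_f pevalC.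
  congr (_ *: _); rewrite big_map -(prodS (fun i => 'X - (br_psi (nth B0 Bs i) lvar^-1)%:P)).
  apply: eq_bigl => i; have [_ _ psiC psix _] := ok i.
  by rewrite /root (ev_branch_reexpand f psiC psix) fmorph_eq0.
exists (size S), B; split.
- have szf : size (swapXY f) = (size S).+1.
    rewrite -(size_map_inj_poly evinf_inj (rmorph0 _)) fac1 size_scale ?fmorph_eq0 //.
    by rewrite size_prod_XsubC -[in RHS](card_ord (size S)) cardT enumT.
  by have := size_swap_factor; rewrite szf.
- move=> i; split; first exact: ok.
  have := mem_tnth i (in_tuple S); rewrite mem_filter => /andP[/eqP]; by [].
- move=> i j eqc; have := c_inj (tnth (in_tuple S) i) (tnth (in_tuple S) j) eqc.
  have x0 : 'I_n by exact: (tnth (in_tuple S) i).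
  rewrite !(tnth_nth x0) => /eqP.
  by rewrite nth_uniq // => /eqP/val_inj.
- by exists l'.
- by exists l.
Qed.

End Factor.

(** * Gaps at a place at infinity *)

Section GenusBound.
Variables (f : bipoly) (r : nat) (B : 'I_r -> branch_data) (i0 : 'I_r) (l l' : CC).
Hypothesis okB : forall i, branch_ok (B i).
Hypothesis injB : forall i j, br_c (B i) = br_c (B j) -> i = j.
Hypotheses (l0 : l != 0) (lead_f : lead_coef f = l%:P).
Hypotheses (l'0 : l' != 0) (lead_f' : lead_coef (swapXY f) = l'%:P).
Hypothesis fac_x : map_poly evinf (swapXY f) = lcc l' *: \prod_i ('X - (branch_x (br_w (B i)))%:P).
Hypothesis fac_y : map_poly evinf f = lcc l *: \prod_i ('X - (br_psi (B i) lvar^-1)%:P).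

Variables (K : fieldType) (iota : {rmorphism CC -> K}) (phi : {rmorphism bipoly -> K}).
Variable sigma : 'I_r -> {rmorphism K -> laurent CC}.
Hypotheses (phiC : forall c, phi (cst c) = iota c) (phi_f : phi f = 0).
Hypothesis fracK : forall u : K, exists a b, phi b != 0 /\ u = phi a / phi b.
Hypothesis sigmaE : forall i a, sigma i (phi a) = ev_branch (br_w (B i)) a.

Variables (m : nat) (u : fps CC).
Hypotheses (m2 : (2 < m)%N) (u0 : fps_ct u != 0).
Hypothesis Dw0 : br_w (B i0) = fps_const (br_c (B i0)) + fps_X ^+ m.+1 * u.

Let x := phi varx.
Let y := phi vary.
Let xi i := branch_x (br_w (B i)).

Lemma sigma_iota i c : sigma i (iota c) = lcc c.
Proof. by rewrite -phiC sigmaE ev_branch_cst. Qed.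
Lemma sigma_x i : sigma i x = xi i.
Proof. by rewrite sigmaE ev_branch_x. Qed.
Lemma sigma_y i : sigma i y = lvar^-1.
Proof. by rewrite sigmaE ev_branch_y. Qed.

(** The first terms add up to the residue of the trace of $bx$ down to $\mathbb{C}(y)$, the second
    ones to that of $by$ down to $\mathbb{C}(x)$; both products are integral over the base. *)
Lemma residue_theorem b : integralOver (peval iota y) b -> integralOver (peval iota x) b ->
  \sum_i (res (sigma i b * xi i) - res (br_psi (B i) (sigma i b / lvar))) = 0.
Proof.
move=> int_y int_x; rewrite sumrB.
(* Exchanging the variables makes $\mathbb{C}[y]$ the coefficient ring, so the trace lemma applies
   to this projection as well. *)
pose psi1 : {rmorphism bipoly -> K} := phi \o swapXY.
have psi1C p : psi1 p%:P = peval iota y p.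
  apply: (poly_rmorph_ext (e1 := psi1 \o polyC)) => [c|].
    by rewrite /= swapXY_polyC map_polyC pevalC -phiC.
  by rewrite /= swapXY_Y pevalX.
have psi1X : psi1 'X = x by rewrite /psi1 /= swapXY_X.
have phiX : phi 'X = y by [].
have phi_polyC p : phi p%:P = peval iota x p.
  apply: (poly_rmorph_ext (e1 := phi \o polyC)) => [c|]; first by rewrite pevalC -phiC.
  by rewrite pevalX.
have sigma_psi1 i p : sigma i (psi1 p%:P) = evinf p.
  rewrite psi1C; apply: (poly_rmorph_ext (e1 := sigma i \o peval iota y)) => [c|].
    by rewrite [LHS]/= !pevalC sigma_iota.
  by rewrite [LHS]/= !pevalX sigma_y.
have sigma_psi1X i : sigma i (psi1 'X) = branch_x (br_w (B i)) by rewrite psi1X sigma_x.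
have frac1 v : exists a b, psi1 b != 0 /\ v = psi1 a / psi1 b.
  have [a [c [c0 Dv]]] := fracK v; exists (swapXY a), (swapXY c).
  by rewrite /psi1 /= !swapXYK.
have psi1f : psi1 (swapXY f) = 0 by rewrite /psi1 /= swapXYK.
have T1 : res (\sum_i sigma i (b * x)) = 0.
  apply: (res_trace_integral frac1 l'0 lead_f' psi1f sigma_psi1 sigma_psi1X fac_x).
  apply: integral_mul; first exact: (eq_integralOver (fun p => esym (psi1C p)) int_y).
  by rewrite -psi1X; exact: (integral_psi l'0 lead_f' psi1f).
pose sigma2 i : {rmorphism K -> laurent CC} := br_psi (B i) \o sigma i.
have sigma2C i p : sigma2 i (phi p%:P) = evinf p.
  have [_ _ psiC psix _] := okB i.
  rewrite phi_polyC; apply: (poly_rmorph_ext (e1 := sigma2 i \o peval iota x)) => [c|].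
    by rewrite [LHS]/= !pevalC sigma_iota psiC.
  by rewrite [LHS]/= !pevalX sigma_x psix.
have sigma2X i : sigma2 i (phi 'X) = br_psi (B i) lvar^-1.
  by rewrite phiX /sigma2 [LHS]/= sigma_y.
have T2 : res (\sum_i sigma2 i (b * y)) = 0.
  apply: (res_trace_integral fracK l0 lead_f phi_f sigma2C sigma2X fac_y).
  apply: integral_mul; first exact: (eq_integralOver (fun p => esym (phi_polyC p)) int_x).
  by rewrite -phiX; exact: (integral_psi l0 lead_f phi_f).
have S1 : \sum_i res (sigma i b * xi i) = 0.
  by rewrite -[RHS]T1 res_sum; apply: eq_bigr => i _; rewrite rmorphM sigma_x.
have S2 : \sum_i res (br_psi (B i) (sigma i b / lvar)) = 0.
  rewrite -[RHS]T2 res_sum; apply: eq_bigr => i _.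
  by rewrite /sigma2 [in RHS]/= (rmorphM (sigma i)) sigma_y.
by rewrite S1 S2 subrr.
Qed.

(** The branch [i0] alone contributes to the residue theorem, with $(m + 1)u(0)a(0)$. *)
Lemma leading_coef_vanishes b a :
    integralOver (peval iota y) b -> integralOver (peval iota x) b ->
    (forall i, i != i0 -> exists a', sigma i b * lvar = lser CC a') ->
    sigma i0 b * lvar ^+ m.-1 = lser CC a ->
  fps_ct a = 0.
Proof.
move=> int_y int_x ord_b Da; have := residue_theorem int_y int_x.
rewrite (bigD1 i0) //= big1 ?addr0 => [|i ne_i].
  have [c0 _ psiC psix psiL] := okB i0.
  rewrite (local_residue c0 m2 Dw0 psiC psix psiL Da) => /eqP.
  by rewrite !mulf_eq0 (negPf u0) orbF pnatr_eq0 /= => /eqP.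
(* Elsewhere the local formula is used with order 3: a simple pole of [b] leaves [b * lvar ^+ 2]
   without constant term. *)
have [c0 Dw psiC psix psiL] := okB i.
have [a' Da'] := ord_b i ne_i.
have Da'' : sigma i b * lvar ^+ 3.-1 = lser CC (a' * fps_X).
  by rewrite exprS mulrA Da' rmorphM.
by rewrite (local_residue c0 (isT : 2 < 3)%N Dw psiC psix psiL Da'') fps_ctM fps_ctX !mulr0.
Qed.

Let O0 := regular_at (sigma i0).

Definition regular_off (h : K) : Prop :=
  forall O, is_place iota O -> ~ same_place O O0 -> O h.

Lemma lvarV_not_regular (a : fps CC) : lvar^-1 <> lser CC a.
Proof.
move=> Da; have := @lser_div_lvar CC 1 a; rewrite rmorph1 mul1r => /(_ Da)/eqP.
by rewrite [fps_ct 1]rmorph1 oner_eq0.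
Qed.

Lemma place_regular_at i : is_place iota (regular_at (sigma i)).
Proof. exact: regular_at_place (sigma_iota i) (sigma_y i). Qed.

Lemma xi_not_regular i (a : fps CC) : xi i <> lser CC a.
Proof.
move=> /lser_div_lvar; rewrite branch_ok_ct //; apply/eqP.
by case: (okB i).
Qed.

(** The other branches give places different from [O0]: the function $x - c_{i_0}y$ is regular at
    [O0] but has a pole wherever $c_i \ne c_{i_0}$. *)
Lemma regular_off_sigma h i : regular_off h -> i != i0 -> exists a, sigma i h = lser CC a.
Proof.
move=> reg_h ne_i; apply: (reg_h _ (place_regular_at i)) => same.
have DxE j (v : fps CC) c k : br_w (B j) = fps_const c + fps_X ^+ k.+1 * v ->
    xi j = lser CC (fps_const c) / lvar + lser CC (fps_X ^+ k * v).
  move=> Dw; rewrite /xi /branch_x Dw rmorphD mulrDl; congr (_ + _).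
  by rewrite exprS -mulrA rmorphM mulrC mulKf ?lvar_neq0.
pose e := x - iota (br_c (B i0)) * y.
have De j : sigma j e = xi j - lser CC (fps_const (br_c (B i0))) / lvar.
  by rewrite rmorphB rmorphM sigma_x sigma_iota sigma_y.
have : regular_at (sigma i) e.
  by apply/same; exists (fps_X ^+ m * u); rewrite De (DxE _ _ _ _ Dw0) addrC addKr.
have [_ Dw _ _ _] := okB i.
case=> a Da.
pose d := fps_const (br_c (B i)) - fps_const (br_c (B i0)).
have Dsi : sigma i e = lser CC d / lvar + lser CC (fps_X ^+ 3 * br_E (B i)).
  by rewrite De (DxE _ _ _ _ Dw) /d (rmorphB (lser CC)) mulrBl addrAC.
have : lser CC d / lvar = lser CC (a - fps_X ^+ 3 * br_E (B i)).
  by rewrite [RHS](rmorphB (lser CC)) -Da Dsi addrK.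
move/lser_div_lvar/eqP.
rewrite fps_ctB !fps_ct_const subr_eq0 => /eqP/injB eq_i.
by rewrite eq_i eqxx in ne_i.
Qed.

(** Both [x] and [y] have a pole at [O0], so a place containing one of them is different from
    [O0]. *)
Lemma regular_off_integral h : regular_off h ->
  integralOver (peval iota y) h /\ integralOver (peval iota x) h.
Proof.
move=> reg_h; split; apply: integral_of_places => O plO Oz; apply: reg_h => // same.
  by have [a] := (same y).1 Oz; rewrite sigma_y; exact: lvarV_not_regular.
by have [a] := (same x).1 Oz; rewrite sigma_x; exact: xi_not_regular.
Qed.

(* The forms [x dy - y dx] and [y (x dy - y dx)] are holomorphic and have orders
   [m - 2] and [m - 3] at the place [O0]: no function regular elsewhere has a pole
   of order [m - 1] or [m - 2] there. *)
Lemma order_gap h a : regular_off h -> sigma i0 h * lvar ^+ m.-1 = lser CC a ->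
  exists a', sigma i0 h * lvar ^+ (m - 3) = lser CC a'.
Proof.
move=> reg_h Da; have [int_y int_x] := regular_off_integral reg_h.
have lv0 : (lvar : laurent CC) != 0 by exact: lvar_neq0.
have drop v n (b : fps CC) : v * lvar ^+ n.+1 = lser CC b -> fps_ct b = 0 ->
    v * lvar ^+ n = lser CC (fps_behead b).
  move=> Dv b0; apply: (mulIf lv0); rewrite -mulrA -exprSr Dv {1}(fps_beheadK b0).
  by rewrite rmorphM mulrC.
have a0 : fps_ct a = 0.
  apply: leading_coef_vanishes int_y int_x _ Da => i /(regular_off_sigma reg_h)[c ->].
  by exists (c * fps_X); rewrite rmorphM.
have Dm : m.-1 = (m - 3).+2 by lia.
have D1 := Da; rewrite Dm in D1.
have D2 := drop _ _ _ D1 a0.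
(* The same argument for [h * y]: the factor [y] turns a pole of order $m - 2$ at [O0] into one of
   order $m - 1$ and creates only simple poles at the other branches. *)
have a1 : fps_ct (fps_behead a) = 0.
  apply: (leading_coef_vanishes (b := h * y)).
  - apply: integral_mul => //.
    by exists ('X - 'X%:P); rewrite ?monicXsubC // /root rmorphB /= map_polyX map_polyC /= hornerXsubC pevalX subrr.
  - apply: integral_mul => //.
    have phi_polyC p : phi p%:P = peval iota x p.
      apply: (poly_rmorph_ext (e1 := phi \o polyC)) => [c|]; first by rewrite pevalC -phiC.
      by rewrite pevalX.
    by apply: (eq_integralOver phi_polyC); exact: (integral_psi l0 lead_f phi_f).
  - move=> i /(regular_off_sigma reg_h)[c Dc]; exists c.
    by rewrite rmorphM sigma_y mulfVK.
  by rewrite rmorphM sigma_y Dm exprSr mulrAC mulrA mulfK.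
by exists (fps_behead (fps_behead a)); exact: drop.
Qed.

(** A function without poles is constant, and this one vanishes at [O0]. *)
Lemma regular_off_zero h b : regular_off h -> sigma i0 h = lvar * lser CC b -> h = 0.
Proof.
move=> reg_h Dh.
(* The element 0 lies in every place, so this is integrality over the constants. *)
have [p p_monic ph] : integralOver (peval iota 0) h.
  apply: integral_of_places => O plO _.
  have [same|] := pselect (same_place O O0); last exact: reg_h.
  by apply/same; exists (fps_X * b); rewrite Dh rmorphM.
have [||a Dha] := closed_root_const (iota := iota) (p := map_poly (horner_eval 0) p) (u := h).
- rewrite -size_poly_gt0 size_map_poly_id0 ?size_poly_gt0 ?monic_neq0 //.
  by rewrite (monicP p_monic) /horner_eval hornerC oner_neq0.
- rewrite -map_poly_comp -(rootP ph); congr (_.[_]); apply: eq_map_poly => q.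
  transitivity ((map_poly iota q).[iota 0]); first by rewrite horner_map.
  by rewrite rmorph0.
rewrite Dha; move: Dh; rewrite Dha sigma_iota -(rmorphM (lser CC) fps_X) => /lser_inj Da.
by have := congr1 fps_ct Da; rewrite fps_ctM fps_ctX mul0r fps_ct_const => ->; rewrite rmorph0.
Qed.

Let D := [:: (O0, (m.-1)%:Z)].

Lemma in_LD_regular h : in_LD iota D h ->
  regular_off h /\ exists a, sigma i0 h * lvar ^+ m.-1 = lser CC a.
Proof.
case=> [->|[Dh offh]].
  split; first by move=> O [[O_0 _] _ _ _ _] _.
  by exists 0; rewrite !rmorph0 mul0r.
split=> [O plO ne_O|].
  have [|t [_]] := offh O plO; last by rewrite expr0z divr1.
  by move=> e [<- //|[]].
have [t [[Ot t0 Ot' unif] Oh]] := Dh _ (or_introl erefl).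
(* Since $1/y$ vanishes at [O0], it is a multiple of the uniformizer [t] and can replace it in the
   bound. *)
have Oy : O0 (y^-1 / t).
  apply: unif; first by exists fps_X; rewrite fmorphV sigma_y invrK.
  by rewrite invrK => -[a]; rewrite sigma_y; exact: lvarV_not_regular.
move: Oh; rewrite -exprnN invrK => -[a Da]; case: Oy => b Db.
exists (a * b ^+ m.-1); rewrite (rmorphM (lser CC)) (rmorphXn (lser CC)) -Da -Db.
rewrite -(rmorphXn (sigma i0)) -(rmorphM (sigma i0)).
have -> : h * t ^+ m.-1 * (y^-1 / t) ^+ m.-1 = h * y^-1 ^+ m.-1.
  by rewrite -mulrA -exprMn mulrCA divff // mulr1.
by rewrite (rmorphM (sigma i0)) (rmorphXn (sigma i0)) fmorphV sigma_y invrK.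
Qed.

(** By [order_gap] the poles have order at most $m - 3$, so $m - 2$ linear conditions force a zero
    at [O0]. Among $m - 1$ functions some nontrivial combination meets them, and it is zero by
    [regular_off_zero]. *)
Lemma not_indep_in_LD : ~ indep_in_LD iota D m.-1.
Proof.
case=> s [sLD indep].
have /choice[a Da] : forall i, exists a, sigma i0 (s i) * lvar ^+ (m - 3) = lser CC a.
  by move=> i; have [reg [b Db]] := in_LD_regular (sLD i); exact: order_gap reg Db.
pose M := \matrix_(i < m.-1, j < m - 2) a i j.
have : kermx M != 0.
  rewrite kermx_eq0 /row_free; apply/eqP => rkM; have := rank_leq_col M.
  by rewrite rkM; lia.
move=> /rowV0Pn[v /sub_kermxP vM v0].
case/eqP: v0; apply/rowP => i; rewrite mxE; move: i; apply: indep.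
set h := \sum_i _.
have reg_h : regular_off h.
  move=> O plO ne_O; have [[O_0 _] OB OM OC _] := plO.
  have OD b c : O b -> O c -> O (b + c).
    by move=> Ob Oc; rewrite -[c]opprK -[- c]sub0r; apply: (OB) => //; apply: (OB).
  rewrite /h; elim/big_ind: _ => // i _; apply: (OM); first exact: OC.
  by have [reg _] := in_LD_regular (sLD i); exact: reg.
pose A := \sum_i fps_const (v 0 i) * a i.
have DA : sigma i0 h * lvar ^+ (m - 3) = lser CC A.
  rewrite /h rmorph_sum mulr_suml rmorph_sum; apply: eq_bigr => i _.
  by rewrite rmorphM sigma_iota -mulrA Da rmorphM.
have A0 j : (j < m - 2)%N -> A j = 0.
  move=> lt_j; rewrite fps_sumE.
  have := congr1 (fun w : 'rV_(m - 2) => w 0 (Ordinal lt_j)) vM; rewrite !mxE => E0; rewrite -[RHS]E0.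
  by apply: eq_bigr => i _; rewrite fps_constME mxE.
have lv0 : (lvar : laurent CC) ^+ (m - 3) != 0 by rewrite expf_neq0 ?lvar_neq0.
apply: (regular_off_zero (b := Fps (fun n => A (n + (m - 2))%N)) reg_h).
apply: (mulIf lv0); rewrite DA [in LHS](fps_dropK A0) rmorphM rmorphXn -/lvar.
have -> : (m - 2 = (m - 3).+1)%N by lia.
by rewrite exprSr -mulrA mulrC.
Qed.

End GenusBound.

(** The least size at which independence fails is $\ell(D) + 1 \le N$, so $\deg D - \ell(D) + 1 \ge
    2$ for $D = N\cdot O$. *)
Lemma genus_gap (K : fieldType) (iota : {rmorphism CC -> K}) (O : K -> Prop) (N : nat) g :
  is_place iota O -> ~ indep_in_LD iota [:: (O, N%:Z)] N -> has_genus iota g -> (1 < g)%N.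
Proof.
move=> plO nindep [bound _].
have exN : exists k, `[< ~ indep_in_LD iota [:: (O, N%:Z)] k >] by exists N; apply/asboolP.
case: (ex_minnP exN) => k /asboolP nk min_k.
have le_kN : (k <= N)%N by apply: min_k; apply/asboolP.
case: k => [|k] in nk min_k le_kN *.
  (* The empty family is independent, so the least size is not 0. *)
  by case: nk; exists (fun i : 'I_0 => 0); split=> [[]|c _ []].
have divD : is_divisor iota [:: (O, N%:Z)].
  split; first by move=> e [<-|[]].
  by move=> i j /= lt_ij lt_j; exfalso; lia.
have indep_k : indep_in_LD iota [:: (O, N%:Z)] k.
  by apply: contrapT => nk'; have := min_k k (asboolT nk'); rewrite ltnn.
have := bound _ k divD (conj indep_k nk).
by rewrite /deg_div big_seq1 /=; lia.
Qed.

Theorem theorem1p1 (P Q : {poly CC}) (n n0 m0 : nat) :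
  size P = n.+1 -> size Q = n.+1 -> (2 <= n)%N ->
  size (P - lead_coef P *: 'X^n) = n0.+1 ->
  size (Q - lead_coef Q *: 'X^n) = m0.+1 ->
  (maxn n0 m0 + 4 <= n)%N ->
  ~ (exists f : bipoly, deg_one f /\ bdvd f (PxQy P Q)) ->
  forall f : bipoly, birreducible f -> bdvd f (PxQy P Q) ->
    ~ curve_has_genus f 0 /\ ~ curve_has_genus f 1.
Proof.
move=> szP szQ n2 szP0 szQ0 le_n nolin f irr_f [g Dfg].
have gap (p : {poly CC}) k : size (p - lead_coef p *: 'X^n) = k.+1 -> (k + 4 <= n)%N ->
    forall i, (n < i + 4)%N -> (i < n)%N -> p`_i = 0.
  move=> szp le_k i lt_n lt_i.
  have : (p - lead_coef p *: 'X^n)`_i = 0 by apply: nth_default; rewrite szp; lia.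
  by rewrite coefB coefZ coefXn ltn_eqF // mulr0 subr0.
have gapP := gap P n0 szP0 ltac:(lia); have gapQ := gap Q m0 szQ0 ltac:(lia).
have n_gt0 : (0 < n)%N by lia.
have [r [B [r0 okB injB [l' [l'0 lead_f' fac_x]] [l [l0 lead_f fac_y]]]]] :=
  factor_branches n_gt0 szP szQ gapP gapQ irr_f Dfg.
pose i0 : 'I_r := Ordinal r0.
have ok i : branch_ok (B i) by case: (okB i).
have evf i : ev_branch (br_w (B i)) f = 0 by case: (okB i).
(* Every branch of [f] has the same kernel, so each one embeds the same function field into Laurent
   series. *)
have ker i h : ev_branch (br_w (B i)) h = 0 <-> bdvd f h.
  apply: (kernel_irreducible irr_f lead_f (evf i)) => p.
  rewrite /ev_branch pevalC; apply: peval_inj => a; apply/eqP => /lser_div_lvar.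
  by rewrite branch_ok_ct //; apply/eqP; case: (ok i).
pose e := ev_branch (br_w (B i0)).
pose phi : {rmorphism bipoly -> image_field e} := to_image e.
pose iota : {rmorphism CC -> image_field e} := phi \o (polyC \o polyC).
have kerphi h : phi h = 0 <-> bdvd f h.
  by apply: iff_trans (ker i0 h); exact: to_image_eq0.
have ffield : is_function_field_of f iota phi.
  by split=> //; split=> // a; exact: image_fieldP.
have /choice[sigma sigmaE] : forall i, exists sigma : {rmorphism image_field e -> laurent CC},
    forall a, sigma (phi a) = ev_branch (br_w (B i)) a.
  move=> i; apply: extend_to_fractions; first exact: image_fieldP.
  by move=> a; apply: iff_trans (kerphi a) _; apply: iff_sym; exact: ker.
have [c0 Dw _ _ _] := ok i0.
(* If the remainder vanished, the branch would lie on the line $x = cy$, and [f] would be a factor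
   of degree one. *)
have E0 : br_E (B i0) != 0.
  apply/negP => /eqP E0; apply: nolin; exists f; split; last by exists g.
  apply: (linear_of_dvd l0 lead_f (size_factor n_gt0 szQ irr_f Dfg) c0).
  apply/(ker i0); rewrite rmorphB rmorphM ev_branch_cst ev_branch_x ev_branch_y.
  by rewrite /branch_x Dw E0 mulr0 addr0 subrr.
(* With [k] the order of the remainder, $s^4 \cdot s^k = s^{m+1}$ for $m = k + 3$. *)
have [k [u [DE u0]]] := fps_valuation E0.
have Dw' : br_w (B i0) = fps_const (br_c (B i0)) + fps_X ^+ (k + 3).+1 * u.
  by rewrite -addnS addnC exprD -mulrA -DE.
have m2 : (2 < k + 3)%N by lia.
have nindep := not_indep_in_LD ok injB l0 lead_f l'0 lead_f' fac_x fac_y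
  (fun c => erefl (iota c)) ((kerphi f).2 (ex_intro _ 1 (esym (mulr1 f))))
  (@image_fieldP _ _ e) sigmaE m2 u0 Dw'.
have plO : is_place iota (regular_at (sigma i0)).
  by apply: (regular_at_place (y := phi vary)) => [c|]; rewrite sigmaE ?ev_branch_cst ?ev_branch_y.
have big g' : curve_has_genus f g' -> (1 < g')%N.
  by move=> /(_ _ iota phi ffield); exact: genus_gap plO nindep.
by split=> /big.
Qed.
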